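(* Let $f_{\mathrm{swsr}}^s$ be the solution of the semi-discrete Vlasov-Poisson equations in the symmetrically weighted (SW) square-root formulation, as given in the context. Consider the total energy $\mathcal{E}(t)=\mathcal{E}_{\mathrm{kin}}(t)+\mathcal{E}_{\mathrm{pot}}(t)$, where $$\mathcal{E}_{\mathrm{kin}}(t)=\frac12\sum_sm^s\int_0^\ell\int_{\mathbb{R}}v^2f_{\mathrm{swsr}}^s(x,v,t)\,\mathrm{d}v\,\mathrm{d}x,\qquad \mathcal{E}_{\mathrm{pot}}(t)=\frac12\int_0^\ell E(x,t)^2\,\mathrm{d}x.$$ The total energy $\mathcal{E}(t)$ is not conserved in time, where the drift rate is $$\begin{aligned}\frac{\mathrm{d}\mathcal{E}}{\mathrm{d}t}=&-\Delta x\frac{N_v}{2}\sqrt{\frac{N_v-1}{2}}\sum_s(\alpha^s)^2\Big(m^s(\alpha^s)^2\,\mathbf{C}_{N_v-1}^s(t)^\top\mathbf{D}^p\mathbf{C}_{N_v-2}^s(t)+q^s\,\mathbf{E}(t)^\top\big(\mathbf{C}_{N_v-2}^s(t)\odot\mathbf{C}_{N_v-1}^s(t)\big)\Big)\\&-\Delta x\,N_v\,\mathbf{E}(t)^\top\sum_sq^su^s\alpha^s\,\mathbf{C}_{N_v-1}^s(t)^2+\Delta x\,\mathbf{E}(t)^\top\sum_s\sum_{n=0}^{N_v-1}q^s\alpha^s\,\mathbf{C}_n^s(t)\odot\mathbf{Q}_n^s(t)\\&-2\Delta x\,\mathbf{E}(t)^\top(\mathbf{D}^p)^\dagger\sum_sq^s\alpha^s\sum_{n=0}^{N_v-1}\mathbf{C}_n^s(t)\odot\big(\mathbf{D}^p\mathbf{Q}_n^s(t)\big),\end{aligned}$$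 where $\mathbf{Q}_n^s=\alpha^s\sqrt{\frac n2}\,\mathbf{C}_{n-1}^s+\alpha^s\sqrt{\frac{n+1}{2}}\,\mathbf{C}_{n+1}^s+u^s\mathbf{C}_n^s$ and $(\mathbf D^p)^\dagger\in\mathbb{R}^{N_x\times N_x}$ is the pseudoinverse of $\mathbf D^p$.
   Context: Finitely many species $s$ have constants $q^s,u^s\in\mathbb{R}$ and $m^s,\alpha^s>0$; $N_v\ge1$ is the number of velocity modes. The spatial domain $[0,\ell]$ is periodic, with a uniform grid $x^{(1)},\dots,x^{(N_x)}$, spacing $\Delta x=\ell/N_x$. Basis: $\psi_n(\xi)=(\sqrt\pi2^nn!)^{-1/2}\mathcal H_n(\xi)e^{-\xi^2/2}$ with physicists' Hermite polynomials $\mathcal H_n$, $\xi^s=(v-u^s)/\alpha^s$. $\mathbf{D}^p\in\mathbb{R}^{N_x\times N_x}$ is the periodic centered finite difference matrix of even order $p$ ($N_x>p$): the circulant matrix $\mathbf{D}^p_{jk}=d^p_{(k-j)\bmod N_x}$ with $d_0^p=0$; for $1\le k\le p/2=:r$, $d_k^p=\frac{1}{\Delta x}\frac{(-1)^{k+1}(r!)^2}{k(r-k)!(r+k)!}$ and $d_{N_x-k}^p=-d_k^p$; all other $d_k^p=0$. Semi-discrete SW square-root system: functions $\mathbf{C}_n^s(t)\in\mathbb{R}^{N_x}$ ($0\le n\le N_v-1$; convention $\mathbf C_n^s=0$ for $n<0$ and $\mathbf C_{N_v}^s=0$) and $\mathbf E(t)=[E(x^{(1)},t),\dots,E(x^{(N_x)},t)]^\top\in\mathbb{R}^{N_x}$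 with $$\frac{\mathrm d\mathbf C_n^s}{\mathrm dt}=-\mathbf D^p\Big(\alpha^s\sqrt{\tfrac n2}\,\mathbf C_{n-1}^s+\alpha^s\sqrt{\tfrac{n+1}2}\,\mathbf C_{n+1}^s+u^s\mathbf C_n^s\Big)+\frac{q^s}{m^s\alpha^s}\mathbf E\odot\Big(\sqrt{\tfrac n2}\,\mathbf C_{n-1}^s-\sqrt{\tfrac{n+1}2}\,\mathbf C_{n+1}^s\Big),$$ $$\mathbf D^p\mathbf E(t)=\sum_sq^s\alpha^s\sum_{n=0}^{N_v-1}\mathbf C_n^s(t)^2,$$ where $\odot$ is the entrywise product, $\mathbf C^2=\mathbf C\odot\mathbf C$, and the condition $\int_0^\ell E(x,t)\,\mathrm dx=0$ is imposed for all $t$ (with the trapezoidal rule below: $\mathbf 1^\top\mathbf E(t)=0$, where $\mathbf 1$ is the all-ones vector). The solution is $f^s_{\mathrm{swsr}}(x^{(j)},v,t)=\Big(\sum_{n=0}^{N_v-1}(\mathbf C_n^s(t))_j\,\psi_n(\xi^s)\Big)^2$. All integrals over $x$ are evaluated by the periodic trapezoidal rule $\int_0^\ell g\,\mathrm dx:=\Delta x\sum_jg(x^{(j)})$, so $\mathcal E_{\mathrm{pot}}=\frac{\Delta x}2\mathbf E^\top\mathbf E$ and $$\mathcal E_{\mathrm{kin}}=\Delta x\sum_sm^s\alpha^s\sum_{n=0}^{N_v-1}\Big[\tfrac12\big((u^s)^2+(\alpha^s)^2n+\tfrac{(\alpha^s)^2}{2}\big)\mathbf C_n^{s\top}\mathbf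 C_n^s+2u^s\alpha^s\sqrt{\tfrac n2}\,\mathbf C_n^{s\top}\mathbf C_{n-1}^s+\tfrac{(\alpha^s)^2}{2}\sqrt{n(n-1)}\,\mathbf C_n^{s\top}\mathbf C_{n-2}^s\Big].$$
   Formalization: For even N_x the Poisson equation and zero mean leave the alternating component of E free (with C=0, q=0, E=c(t)(1,-1,1,...) the drift formula fails), so the formal statement also requires that component of E to vanish when N_x is even. *)

(* Defs.v *)
From HB Require Import structures.
From mathcomp Require Import all_boot all_order all_algebra.
From mathcomp Require Import all_classical all_reals all_analysis.

Set Implicit Arguments.
Unset Strict Implicit.
Unset Printing Implicit Defensive.

Import Order.TTheory GRing.Theory Num.Theory.
Import numFieldNormedType.Exports.

Local Open Scope classical_set_scope.
Local Open Scope ring_scope.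

(* [pinvmx] of mxalgebra is only some partial inverse, so the Moore-Penrose
   pseudoinverse of a real matrix is defined here, by the formula
   A^+ = V^T (V V^T)^-1 (U^T U)^-1 U^T for the full rank factorization
   A = U V.  [mp_pinvP] and [is_mp_pinv_uniq] certify it. *)
Definition mp_pinv (F : realFieldType) (m n : nat) (A : 'M[F]_(m, n)) :
    'M[F]_(n, m) :=
  let U := col_base A in
  let V := row_base A in
  V^T *m invmx (V *m V^T) *m invmx (U^T *m U) *m U^T.

Record is_mp_pinv (F : realFieldType) (m n : nat) (A : 'M[F]_(m, n))
    (X : 'M[F]_(n, m)) : Prop := IsMpPinv {
  mp_pinvAXA : A *m X *m A = A;
  mp_pinvXAX : X *m A *m X = X;
  mp_pinvAX_sym : (A *m X)^T = A *m X;
  mp_pinvXA_sym : (X *m A)^T = X *m A }.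

Lemma is_mp_pinv_uniq (F : realFieldType) (m n : nat) (A : 'M[F]_(m, n))
    (X Y : 'M[F]_(n, m)) :
  is_mp_pinv A X -> is_mp_pinv A Y -> X = Y.
Proof.
move=> [AXA XAX AX XA] [AYA YAY AY YA].
have eqAXY : A *m X = A *m Y.
  by rewrite -[LHS]AX -{1}AYA -mulmxA trmx_mul AX AY mulmxA AXA.
have eqXYA : X *m A = Y *m A.
  by rewrite -[LHS]XA -{1}AYA -(mulmxA A) mulmxA trmx_mul XA YA -!mulmxA
             (mulmxA A) AXA.
by rewrite -XAX -mulmxA eqAXY mulmxA eqXYA YAY.
Qed.

Lemma gram_unitmx (F : realFieldType) (m n : nat) (A : 'M[F]_(m, n)) :
  row_free A -> A *m A^T \in unitmx.
Proof.
move=> Afree; rewrite -row_free_unit -kermx_eq0; apply/rowV0P => v.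
move=> /sub_kermxP vAA.
have vA0 : v *m A = 0.
  have /matrixP/(_ 0 0) : (v *m A) *m (v *m A)^T = 0.
    by rewrite trmx_mul mulmxA -(mulmxA v) vAA mul0mx.
  rewrite !mxE => /eqP; rewrite psumr_eq0; last first.
    by move=> i _; rewrite !mxE -expr2 sqr_ge0.
  move=> /allP vA; apply/rowP => i; have := vA i (mem_index_enum i).
  by rewrite !mxE -expr2 sqrf_eq0 => /eqP.
by apply: (row_free_inj Afree); rewrite mul0mx.
Qed.

Lemma mp_pinvP (F : realFieldType) (m n : nat) (A : 'M[F]_(m, n)) :
  is_mp_pinv A (mp_pinv A).
Proof.
rewrite /mp_pinv; set U := col_base A; set V := row_base A.
have AE : A = U *m V by rewrite mulmx_base.
have Vu : V *m V^T \in unitmx by apply: gram_unitmx; exact: row_base_free.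
have Uu : U^T *m U \in unitmx.
  rewrite -{2}[U]trmxK; apply: gram_unitmx.
  by rewrite /row_free mxrank_tr; have := col_base_full A; rewrite /row_full.
clearbody U V; set G := invmx (V *m V^T); set H := invmx (U^T *m U).
have Gs : G^T = G by rewrite /G trmx_inv trmx_mul trmxK.
have Hs : H^T = H by rewrite /H trmx_inv trmx_mul trmxK.
have VG (k : nat) (B : 'M[F]_(\rank A, k)) : V *m (V^T *m (G *m B)) = B.
  by rewrite mulmxA mulmxA mulmxV // mul1mx.
have HU (k : nat) (B : 'M[F]_(\rank A, k)) : H *m (U^T *m (U *m B)) = B.
  by rewrite (mulmxA U^T) mulmxA mulVmx // mul1mx.
have AX : A *m (V^T *m G *m H *m U^T) = U *m H *m U^T.
  by rewrite [X in X *m _]AE -!mulmxA VG.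
have XA : (V^T *m G *m H *m U^T) *m A = V^T *m G *m V.
  by rewrite [X in _ *m X]AE -!mulmxA HU.
split.
- by rewrite AX [X in _ *m X]AE -!mulmxA HU -AE.
- by rewrite XA -!mulmxA VG.
- by rewrite AX !trmx_mul trmxK Hs mulmxA.
- by rewrite XA !trmx_mul trmxK Gs mulmxA.
Qed.

(* Physicists' Hermite polynomials: differentiating
   H_n(x) = (-1)^n e^(x^2) (d/dx)^n e^(-x^2) gives H_(n+1) = 2 x H_n - H_n'. *)
Fixpoint hermite (R : realType) (n : nat) : {poly R} :=
  if n is n'.+1 then 2%:P * 'X * hermite R n' - (hermite R n')^`() else 1.

Definition hermite_fun (R : realType) (n : nat) (xi : R) : R :=
  (Num.sqrt (Num.sqrt pi * 2 ^+ n * n`!%:R))^-1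
  * (hermite R n).[xi] * expR (- xi ^+ 2 / 2).

Definition dotmx (R : realType) (N : nat) (x y : 'cV[R]_N) : R :=
  (x^T *m y) 0 0.

Definition hadamard (R : realType) (N : nat) (x y : 'cV[R]_N) : 'cV[R]_N :=
  map2_mx *%R x y.

Notation "x \odot y" := (hadamard x y)
  (at level 40, left associativity) : ring_scope.

Record sw_params (R : realType) := SwParams {
  species : finType;
  sp_charge : species -> R;      (* q^s *)
  sp_shift : species -> R;       (* u^s *)
  sp_mass : species -> R;        (* m^s *)
  sp_width : species -> R;       (* alpha^s *)
  dom_len : R;                    (* length of the periodic spatial domain *)
  Nx : nat;
  Nv : nat;
  fd_order : nat;                (* order p of the finite differences *)
  mass_gt0 : forall s, 0 < sp_mass s;
  width_gt0 : forall s, 0 < sp_width s;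
  len_gt0 : 0 < dom_len;
  Nv_gt0 : (0 < Nv)%N;
  order_even : ~~ odd fd_order;
  order_gt0 : (0 < fd_order)%N;
  order_lt_Nx : (fd_order < Nx)%N }.

Arguments sp_charge {R} _ _.
Arguments sp_shift {R} _ _.
Arguments sp_mass {R} _ _.
Arguments sp_width {R} _ _.
Arguments dom_len {R} _.
Arguments Nx {R} _.
Arguments Nv {R} _.
Arguments fd_order {R} _.

Definition dx (R : realType) (P : sw_params R) : R := dom_len P / (Nx P)%:R.

(* Periodic trapezoidal rule; [g j] is the value at the j-th grid point. *)
Definition trapezoid (R : realType) (P : sw_params R) (g : 'I_(Nx P) -> R) : R :=
  dx P * \sum_j g j.

Definition fd_weight (R : realType) (P : sw_params R) (k : nat) : R :=
  let r := (fd_order P)./2 in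
  (dx P)^-1 * ((-1) ^+ k.+1 * r`!%:R ^+ 2
               / (k%:R * (r - k)`!%:R * (r + k)`!%:R)).

Definition fd_coef (R : realType) (P : sw_params R) (k : nat) : R :=
  let r := (fd_order P)./2 in
  if (1 <= k <= r)%N then fd_weight P k
  else if (1 <= Nx P - k <= r)%N then - fd_weight P (Nx P - k)
  else 0.

(* [k + (Nx P - j)] is k - j modulo [Nx P]; the subtraction is not truncated. *)
Definition fd_mx (R : realType) (P : sw_params R) : 'M[R]_(Nx P) :=
  \matrix_(j, k) fd_coef P ((k + (Nx P - j)) %% Nx P)%N.

(* [C s n t] is the vector C_n^s(t); the mode index is an integer, so that
   n - 1 and n - 2 are never truncated. *)
Definition coefs (R : realType) (P : sw_params R) : Type :=
  species P -> int -> R -> 'cV[R]_(Nx P).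

Definition efield (R : realType) (P : sw_params R) : Type := R -> 'cV[R]_(Nx P).

Definition Qvec (R : realType) (P : sw_params R) (C : coefs P)
    (s : species P) (n : nat) (t : R) : 'cV[R]_(Nx P) :=
  (sp_width P s * Num.sqrt (n%:R / 2)) *: C s (n%:Z - 1) t
  + (sp_width P s * Num.sqrt (n.+1%:R / 2)) *: C s (n%:Z + 1) t
  + sp_shift P s *: C s n%:Z t.

Definition sw_rhs (R : realType) (P : sw_params R) (C : coefs P) (E : efield P)
    (s : species P) (n : nat) (t : R) : 'cV[R]_(Nx P) :=
  - (fd_mx P *m Qvec C s n t)
  + (sp_charge P s / (sp_mass P s * sp_width P s)) *:
      (E t \odot (Num.sqrt (n%:R / 2) *: C s (n%:Z - 1) t
                  - Num.sqrt (n.+1%:R / 2) *: C s (n%:Z + 1) t)).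

(* Solutions on the set [I] of times.  The last condition is void when [Nx P]
   is odd.  When [Nx P] is even, the kernel of [fd_mx P] is spanned by the
   constant and the alternating vectors, so that the Poisson equation and the
   zero mean condition leave the alternating component of [E] undetermined
   (an arbitrary function of time); like the mean, it is fixed to 0. *)
Record sw_solution (R : realType) (P : sw_params R) (I : set R)
    (C : coefs P) (E : efield P) : Prop := SwSolution {
  sw_conv_lo : forall s (n : int) t, I t -> n < 0 -> C s n t = 0;
  sw_conv_hi : forall s t, I t -> C s (Nv P)%:Z t = 0;
  sw_vlasov : forall s (n : nat) t (j : 'I_(Nx P)), I t -> (n < Nv P)%N ->
    is_derive t 1 (fun t' => C s n%:Z t' j 0) (sw_rhs C E s n t j 0);
  sw_poisson : forall t, I t ->
    fd_mx P *m E t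
    = \sum_s (sp_charge P s * sp_width P s) *:
        \sum_(n < Nv P) (C s n%:Z t \odot C s n%:Z t);
  sw_mean0 : forall t, I t -> trapezoid (fun j => E t j 0) = 0;
  sw_gauge : forall t, I t -> ~~ odd (Nx P) ->
    \sum_(j < Nx P) (-1) ^+ j * E t j 0 = 0 }.

Definition f_swsr (R : realType) (P : sw_params R) (C : coefs P)
    (s : species P) (j : 'I_(Nx P)) (v t : R) : R :=
  (\sum_(n < Nv P) C s n%:Z t j 0
     * hermite_fun n ((v - sp_shift P s) / sp_width P s)) ^+ 2.

Definition energy_kin (R : realType) (P : sw_params R) (C : coefs P) (t : R) : R :=
  2^-1 * \sum_s sp_mass P s *
    trapezoid (fun j =>
      \int[@lebesgue_measure R]_v (v ^+ 2 * f_swsr C s j v t)).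

Definition energy_pot (R : realType) (P : sw_params R) (E : efield P) (t : R) : R :=
  2^-1 * trapezoid (fun j => E t j 0 ^+ 2).

Definition energy (R : realType) (P : sw_params R) (C : coefs P) (E : efield P)
    (t : R) : R :=
  energy_kin C t + energy_pot E t.

Definition drift_rate (R : realType) (P : sw_params R) (C : coefs P)
    (E : efield P) (t : R) : R :=
  let N := Nv P in
  let D := fd_mx P in
  let q := sp_charge P in
  let u := sp_shift P in
  let m := sp_mass P in
  let a := sp_width P in
  - dx P * (N%:R / 2) * Num.sqrt ((N%:R - 1) / 2) *
      (\sum_s a s ^+ 2 *
         (m s * a s ^+ 2 * dotmx (C s (N%:Z - 1) t) (D *m C s (N%:Z - 2) t)
          + q s * dotmx (E t) (C s (N%:Z - 2) t \odot C s (N%:Z - 1) t)))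
  - dx P * N%:R *
      dotmx (E t) (\sum_s (q s * u s * a s) *:
                     (C s (N%:Z - 1) t \odot C s (N%:Z - 1) t))
  + dx P *
      dotmx (E t) (\sum_s \sum_(n < N)
                     (q s * a s) *: (C s n%:Z t \odot Qvec C s n t))
  - 2 * dx P *
      dotmx (E t) (mp_pinv D *m
        \sum_s (q s * a s) *:
          \sum_(n < N) (C s n%:Z t \odot (D *m Qvec C s n t))).

(* Main.v *)
Require Import Defs.
From HB Require Import structures.
From mathcomp Require Import all_boot all_order all_algebra.
From mathcomp Require Import all_classical all_reals all_analysis.
From mathcomp Require Import measurable_realfun.
From mathcomp Require Import ring lra zify.

Import Order.TTheory GRing.Theory Num.Theory.
Import numFieldNormedType.Exports.

Set Implicit Arguments.
Unset Strict Implicit.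
Unset Printing Implicit Defensive.

Local Open Scope classical_set_scope.
Local Open Scope ring_scope.

(** The kinetic energy density of a species is the squared norm of v times its
    square root.  By the three-term recurrence, multiplication by v acts on
    Hermite coefficients as a symmetric tridiagonal matrix V, and the functions
    are orthonormal, so up to constants the energy is the sum of the squares
    |Q_n|^2 of the coefficients Q = V C ([integral_velocity]).  The index n runs over one mode
    more than the expansion: V pushes the last mode out of the truncated space.

    The drift comes from that extra mode.  By symmetry of V
    ([velocity_coef_adjoint]) half the derivative of the sum of |Q_n|^2 is the
    sum of (V Q)_n C_n' over the modes of the truncation.  The two parts of C_n'
    telescope in n.  For transport, - D Q_n, the matrix D is antisymmetric, and
    the pairing of (V Q)_n with D Q_n is a difference of fluxes in n
    ([sum_transport]).  For the force, multiplication by xi and the derivative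
    in xi satisfy the canonical commutation relation, so that the pairing is
    alpha C_n Q_n plus a difference of fluxes ([force_telescope]).  Only the
    fluxes at n = N_v survive; they and the alpha C_n Q_n are the first three
    terms of the drift rate ([kinetic_rate]).

    For the potential energy, E has to be recovered from the charge density
    rho.  The matrix D is the odd operator S - S^-1, S being the shift, times a
    positive combination of powers of the positive semidefinite operator
    (1 - S)(1 - S)^T, where the power zero occurs with a positive coefficient.
    So the kernel of D is that of S - S^-1 ([cd_poly_kernel], [fd_mx_kernel]).
    As E has no component on it, E is the image of rho under the pseudoinverse
    ([poisson_pinv]); differentiating this gives the last term of the drift
    rate, because the force drops out of rho'.

    The energy varies already with one mode and four grid points.  Two species
    of opposite charge are advected with equal speed, so that their kinetic
    energies are constant; but the difference of their squares is a Fourier mode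
    with an oscillating amplitude, and the field energy oscillates with it
    ([ex_energy_neq]). *)

(** * Polynomials against the Gaussian *)

Section GaussMoments.
Variable R : realType.
Implicit Types (p q : {poly R}) (x : R).

Let mu := @lebesgue_measure R.

(** Half of the Gaussian weight absorbs any power, the other half remains to
    dominate the integrals. *)
Lemma norm_exp_le_expR (n : nat) :
  exists2 C : R, 0 <= C & forall x, `|x| ^+ n <= C * expR (x ^+ 2 / 2).
Proof.
exists (1 + 2 ^+ n.+1 * n.+1`!%:R) => [|x].
  by rewrite addr_ge0// mulr_ge0// exprn_ge0.
have y0 : 0 <= x ^+ 2 / 2 by rewrite divr_ge0 ?sqr_ge0.
have e1 : 1 <= expR (x ^+ 2 / 2) by rewrite -[leLHS]expR0 ler_expR.
have [x1|x1] := leP `|x| 1.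
  rewrite (@le_trans _ _ 1)//; first by rewrite exprn_ile1.
  rewrite (le_trans e1)// ler_peMl ?expR_ge0// lerDl.
  by rewrite mulr_ge0// exprn_ge0.
rewrite mulrDl mul1r ler_wpDl ?expR_ge0//.
(* An even power is reached, which one term of the exponential series at
   x^2 / 2 bounds. *)
apply: (@le_trans _ _ (`|x| ^+ (2 * n.+1))).
  by rewrite ler_weXn2l ?(ltW x1)//; lia.
have -> : `|x| ^+ (2 * n.+1) = 2 ^+ n.+1 * n.+1`!%:R *
    ((x ^+ 2 / 2) ^+ n.+1 / n.+1`!%:R).
  have f0 : n.+1`!%:R != 0 :> R by rewrite pnatr_eq0 -lt0n fact_gt0.
  rewrite exprM real_normK ?num_real// expr_div_n.
  have t0 : 2 ^+ n.+1 != 0 :> R by rewrite expf_neq0.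
  by move: f0 t0; set f := n.+1`!%:R; set t := 2 ^+ _ => f0 t0; field; rewrite t0 f0.
rewrite ler_wpM2l// ?mulr_ge0 ?exprn_ge0//.
by apply: le_trans (expR_ge1Dxn n y0); rewrite lerDr.
Qed.

Lemma horner_le_expR p :
  exists2 C : R, 0 <= C & forall x, `|p.[x]| <= C * expR (x ^+ 2 / 2).
Proof.
have [c c0 cP] : exists2 c : nat -> R, (forall n, 0 <= c n) &
    forall n x, `|x| ^+ n <= c n * expR (x ^+ 2 / 2).
  have /choice[c cP] : forall n, exists C : R, 0 <= C /\
      forall x, `|x| ^+ n <= C * expR (x ^+ 2 / 2).
    by move=> n; have [C C0 CP] := norm_exp_le_expR n; exists C.
  by exists c => n; have [] := cP n.
exists (\sum_(i < size p) `|p`_i| * c i) => [|x].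
  by apply: sumr_ge0 => i _; rewrite mulr_ge0.
rewrite horner_coef (le_trans (ler_norm_sum _ _ _))// mulr_suml.
apply: ler_sum => i _; rewrite normrM normrX -mulrA.
exact: ler_wpM2l.
Qed.

Lemma horner_gauss_le p : exists2 C : R, 0 <= C &
  forall x, `|p.[x] * gauss_fun x| <= C * expR (- (x ^+ 2 / 2)).
Proof.
have [C C0 CP] := horner_le_expR p; exists C => // x.
have -> : gauss_fun x = expR (- (x ^+ 2 / 2)) * expR (- (x ^+ 2 / 2)) :> R.
  by rewrite -expRD /gauss_fun; congr expR; field.
rewrite mulrA normrM [X in _ * X]ger0_norm ?expR_ge0//.
rewrite ler_wpM2r ?expR_ge0// normrM [X in _ * X]ger0_norm ?expR_ge0//.
by rewrite expRN ler_pdivrMr ?expR_gt0.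
Qed.

Lemma continuous_horner_gauss p : continuous (fun x => p.[x] * gauss_fun x).
Proof.
move=> x; apply: cvgM; first exact: continuous_horner.
exact: continuous_gauss_fun.
Qed.

Lemma integrable_horner_gauss p :
  mu.-integrable setT (fun x => (p.[x] * gauss_fun x)%:E).
Proof.
have [C C0 CP] := horner_gauss_le p.
have mp : measurable_fun setT (fun x => (p.[x] * gauss_fun x)).
  by apply: continuous_measurable_fun; exact: continuous_horner_gauss.
apply: (@le_integrable _ _ _ mu setT measurableT _
  (fun x => ((C / normal_peak 1)%:E * (normal_pdf 0 1 x)%:E)%E)).
- exact/measurable_EFinP.
- move=> x _; rewrite normal_pdfE ?oner_neq0// /normal_fun subr0 !abse_EFin.
  rewrite lee_fin mulrA divfK ?gt_eqF ?normal_peak_gt0//.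
  rewrite (le_trans (CP x))// (le_trans _ (ler_norm _))//.
  by rewrite expr1n mulNr.
- by apply: integrableZl => //; exact: integrable_normal_pdf.
Qed.

(** The sign s selects the end of the line; the integers n + 1 suffice for the
    primitives evaluated at the ends of growing segments. *)
Lemma cvg_horner_gauss p (s : R) : `|s| = 1 ->
  (p.[s * n.+1%:R] * gauss_fun (s * n.+1%:R)) @[n --> \oo] --> (0 : R).
Proof.
move=> s1; have [C C0 CP] := horner_gauss_le p.
apply/cvgr0Pnorm_le => e e0.
have C2 : (2 * C) * harmonic n @[n --> \oo] --> (0 : R).
  by rewrite -[X in _ --> X](mulr0 (2 * C)); apply: cvgMr; exact: cvg_harmonic.
near=> n.
apply: le_trans (CP _) _.
have : (2 * C) * harmonic n <= e.
  near: n; move/cvgr0_norm_le: C2 => /(_ e e0); apply: filterS => n.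
  by apply: le_trans; exact: ler_norm.
move=> /(le_trans _); apply; rewrite (mulrC 2) -(mulrA C) ler_wpM2l//.
rewrite exprMn -real_normK ?num_real// s1 expr1n mul1r expRN /=.
rewrite -[leRHS]invrK lef_pV2 ?posrE ?expR_gt0 ?invr_gt0 ?mulr_gt0//.
rewrite invfM invrK (le_trans _ (expR_ge1Dx _))//.
(* With y = n + 1 the goal is y / 2 <= 1 + y^2 / 2. *)
have : 0 <= (n.+1%:R - 1 : R) ^+ 2 by exact: sqr_ge0.
by set y := n.+1%:R; nra.
Unshelve. all: end_near. Qed.

Lemma is_derive_horner_gauss p x :
  is_derive x 1 (fun y => p.[y] * gauss_fun y)
    ((p^`() - 2%:P * 'X * p).[x] * gauss_fun x).
Proof.
rewrite /gauss_fun; apply: is_derive_eq; rewrite !hornerE /GRing.scale/=.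
ring.
Qed.

(** The integrand is the derivative of [p] times the Gaussian, which vanishes
    at both ends: dominated convergence reduces the integral to segments. *)
Lemma integral_derive_horner_gauss p :
  (\int[mu]_x (((p^`() - 2%:P * 'X * p).[x] * gauss_fun x)%:E) = 0)%E.
Proof.
set f := fun x => (p^`() - 2%:P * 'X * p).[x] * gauss_fun x.
pose F x := p.[x] * gauss_fun x.
have cF : continuous F by exact: continuous_horner_gauss.
have cf : continuous f by exact: continuous_horner_gauss.
have mf : measurable_fun setT f by apply: continuous_measurable_fun.
pose D n := `[- n.+1%:R : R, n.+1%:R]%classic.
pose f_ n := EFin \o (f \_ (D n)).
have iD n : (\int[mu]_x f_ n x = (F n.+1%:R - F (- n.+1%:R))%:E)%E.
  rewrite /f_ -restrict_EFin -integral_mkcond.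
  have dF x : is_derive x 1 F (f x) by exact: is_derive_horner_gauss.
  apply: continuous_FTC2.
  - by rewrite (@lt_trans _ _ 0)// oppr_lt0.
  - exact: continuous_subspaceT.
  - split => [x _||]; first by have [] := dF x.
    + by apply: cvg_at_right_filter; exact: cF.
    + by apply: cvg_at_left_filter; exact: cF.
  - by move=> x _; rewrite derive1E; have [_ ->] := dF x.
have [] := @dominated_convergence _ _ _ mu setT measurableT f_ (EFin \o f)
   (fun x => `|(f x)%:E|%E).
- move=> n; apply/measurable_EFinP.
  apply: (measurable_restrictT _ _).1; first exact: measurable_itv.
  exact: measurable_funTS.
- exact/measurable_EFinP.
- apply: aeW => x _; apply: cvg_near_cst.
  near=> n; rewrite /f_/= patchE mem_set//=.
  rewrite /D/= in_itv/= -ler_norml; near: n.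
  apply: filterS (nbhs_infty_ger `|x|) => n /le_trans; apply.
  by rewrite ler_nat.
- by apply: integrable_abse; exact: integrable_horner_gauss.
- apply: aeW => x n _; rewrite /f_/= patchE; case: ifPn => // _.
  by rewrite normr0 lee_fin.
move=> _ _ cvgf.
have cvg0 : (F n.+1%:R - F (- n.+1%:R))%:E @[n --> \oo] --> (0 : R)%:E.
  apply: cvg_EFin; first exact: nearW.
  rewrite -[X in _ --> X](subr0 0); apply: cvgB.
    have := @cvg_horner_gauss p 1; rewrite normr1 => /(_ erefl).
    by under eq_cvg do rewrite mul1r.
  have := @cvg_horner_gauss p (-1); rewrite normrN1 => /(_ erefl).
  by under eq_cvg do rewrite mulN1r.
apply: (cvg_unique _ cvgf) => //=.
by under eq_cvg do rewrite iD.
Unshelve. all: end_near. Qed.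

End GaussMoments.

(** * Hermite functions and the velocity moment *)

Section Hermite.
Variable R : realType.
Implicit Types (p q : {poly R}) (x : R).

Let mu := @lebesgue_measure R.

Definition gauss_int p : R := \int[mu]_x (p.[x] * gauss_fun x).

Lemma gauss_intD p q : gauss_int (p + q) = gauss_int p + gauss_int q.
Proof.
rewrite /gauss_int -RintegralD//; try exact: integrable_horner_gauss.
by apply: eq_Rintegral => x _; rewrite hornerD mulrDl.
Qed.

Lemma gauss_intZ (a : R) p : gauss_int (a *: p) = a * gauss_int p.
Proof.
rewrite /gauss_int -RintegralZl//; last exact: integrable_horner_gauss.
by apply: eq_Rintegral => x _; rewrite hornerZ mulrA.
Qed.

Lemma gauss_int0 : gauss_int 0 = 0.
Proof. by rewrite -(scale0r 0) gauss_intZ mul0r. Qed.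

Lemma gauss_int_sum n (p : 'I_n -> {poly R}) :
  gauss_int (\sum_(i < n) p i) = \sum_(i < n) gauss_int (p i).
Proof. by apply: (big_morph _ gauss_intD gauss_int0). Qed.

Lemma gauss_int1 : gauss_int 1 = Num.sqrt pi.
Proof.
rewrite /gauss_int /Rintegral.
under eq_integral do rewrite hornerC mul1r.
by rewrite integralT_gauss.
Qed.

Lemma gauss_int_by_parts p : gauss_int (2%:P * 'X * p) = gauss_int p^`().
Proof.
apply/eqP; rewrite eq_sym -subr_eq0 -mulN1r -gauss_intZ -gauss_intD scaleN1r.
by rewrite /gauss_int /Rintegral integral_derive_horner_gauss.
Qed.

Lemma deriv_hermite n : (hermite R n.+1)^`() = (2 * n.+1%:R) *: hermite R n.
Proof.
elim: n => [|n IHn].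
  rewrite /= mulr1 -[X in _ - X^`()]polyC1 derivC subr0 derivM derivC derivX.
  by rewrite mul0r add0r !mulr1 alg_polyC.
rewrite [hermite R n.+2]/= derivB !derivM derivC derivX mul0r add0r mulr1 IHn.
rewrite derivZ [in RHS]/hermite -/(hermite R n.+1) [in RHS]/=.
rewrite -!mul_polyC -[n.+2]add1n natrD.
rewrite -/(hermite R n.+1) [hermite R n.+1]/=.
by rewrite !polyCM !polyCD; ring.
Qed.

(** The operator p |-> 2 X p - p' of the Hermite recurrence is the adjoint of
    differentiation for the Gaussian weight. *)
Lemma gauss_int_hermiteM n p :
  gauss_int (hermite R n.+1 * p) = gauss_int (hermite R n * p^`()).
Proof.
have -> : hermite R n.+1 * p =
    2%:P * 'X * (hermite R n * p) + -1 *: ((hermite R n)^`() * p).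
  by rewrite scaleN1r /=; ring.
rewrite gauss_intD gauss_int_by_parts derivM gauss_intD gauss_intZ; ring.
Qed.

Lemma hermite_orthogonal m n : gauss_int (hermite R m * hermite R n) =
  (m == n)%:R * (Num.sqrt pi * 2 ^+ n * n`!%:R).
Proof.
elim: m n => [|m IHm] [|n].
- by rewrite mulr1 gauss_int1 expr0 fact0 !mulr1 mul1r.
- by rewrite mulrC gauss_int_hermiteM derivC mulr0 gauss_int0 mul0r.
- by rewrite gauss_int_hermiteM derivC mulr0 gauss_int0 mul0r.
rewrite gauss_int_hermiteM deriv_hermite -scalerAr gauss_intZ IHm eqSS.
by rewrite factS natrM exprS; ring.
Qed.

(** The matrix entries of the creation and annihilation operators between the
    modes n - 1 and n. *)
Definition ladder (n : nat) : R := Num.sqrt (n%:R / 2).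

Lemma ladder0 : ladder 0 = 0.
Proof. by rewrite /ladder mul0r sqrtr0. Qed.

Lemma sqr_ladder n : ladder n ^+ 2 = n%:R / 2.
Proof. by rewrite sqr_sqrtr// divr_ge0. Qed.

Definition hermite_norm (n : nat) : R := Num.sqrt (Num.sqrt pi * 2 ^+ n * n`!%:R).

Lemma hermite_norm_gt0 n : 0 < hermite_norm n.
Proof.
by rewrite sqrtr_gt0 !mulr_gt0 ?exprn_gt0 ?sqrtr_gt0 ?pi_gt0// ltr0n fact_gt0.
Qed.

Lemma sqr_hermite_norm n :
  hermite_norm n ^+ 2 = Num.sqrt pi * 2 ^+ n * n`!%:R.
Proof. by rewrite sqr_sqrtr// !mulr_ge0 ?exprn_ge0 ?sqrtr_ge0. Qed.

Lemma hermite_normS n : hermite_norm n.+1 = 2 * ladder n.+1 * hermite_norm n.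
Proof.
have Lge0 : 0 <= 2 * ladder n.+1 * hermite_norm n.
  by rewrite !mulr_ge0 ?sqrtr_ge0.
apply/eqP; rewrite -(@eqrXn2 _ 2)// ?sqrtr_ge0//; apply/eqP.
by rewrite !exprMn !sqr_hermite_norm sqr_ladder factS natrM exprS; field.
Qed.

Lemma ladder_neq0 n : ladder n.+1 != 0.
Proof. by rewrite gt_eqF// sqrtr_gt0 divr_gt0. Qed.

Lemma hermite_three_term n x :
  x * hermite_fun n x =
    ladder n * hermite_fun n.-1 x + ladder n.+1 * hermite_fun n.+1 x.
Proof.
have Nn0 k : hermite_norm k != 0 by rewrite gt_eqF// hermite_norm_gt0.
have HS k : (hermite R k.+1).[x] =
    2 * x * (hermite R k).[x] - (hermite R k)^`().[x] by rewrite /= !hornerE.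
rewrite /hermite_fun -!/(hermite_norm _) hermite_normS; case: n => [|n].
  rewrite ladder0 mul0r add0r HS /= -polyC1 derivC !hornerE /=.
  by field; rewrite ladder_neq0 Nn0.
rewrite [hermite_norm n.+1]hermite_normS (HS n.+1) deriv_hermite [n.+1.-1]/= hornerZ.
have -> : n.+1%:R = 2 * ladder n.+1 ^+ 2 by rewrite sqr_ladder; field.
by field; rewrite !ladder_neq0 Nn0.
Qed.

Lemma integral_hermite_sqr (c : nat -> R) N :
  \int[mu]_x (\sum_(n < N) c n * hermite_fun n x) ^+ 2 = \sum_(n < N) c n ^+ 2.
Proof.
pose p : {poly R} := \sum_(n < N) (c n / hermite_norm n) *: hermite R n.
transitivity (gauss_int (p * p)).
  apply: eq_Rintegral => x _.
  have -> : \sum_(n < N) c n * hermite_fun n x = p.[x] * expR (- x ^+ 2 / 2).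
    rewrite horner_sum mulr_suml; apply: eq_bigr => n _.
    by rewrite hornerZ /hermite_fun -/(hermite_norm n); ring.
  rewrite exprMn hornerM -!expr2; congr (_ * _).
  by rewrite expr2 -expRD /gauss_fun; congr expR; field.
rewrite {1}/p mulr_suml gauss_int_sum; apply: eq_bigr => i _.
rewrite -scalerAl gauss_intZ /p mulr_sumr gauss_int_sum (bigD1 i)//= big1 ?addr0.
  rewrite -scalerAr gauss_intZ hermite_orthogonal eqxx mul1r -sqr_hermite_norm.
  by field; rewrite gt_eqF// hermite_norm_gt0.
move=> k ki; rewrite -scalerAr gauss_intZ hermite_orthogonal.
by rewrite (inj_eq val_inj) eq_sym (negbTE ki) mul0r mulr0.
Qed.

Lemma is_derive_affine (u a v : R) :
  is_derive v 1 (fun v => (v - u) / a) a^-1.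
Proof. by apply: is_derive_eq; rewrite /GRing.scale/=; ring. Qed.

(** Nonnegativity of [G] replaces integrability: if the integrals are infinite,
    both sides are 0 by the convention of real-valued integrals. *)
Lemma integral_affine (G : R -> R) (u a : R) : 0 < a -> continuous G ->
  (forall x, 0 <= G x) -> \int[mu]_x G ((x - u) / a) = a * \int[mu]_x G x.
Proof.
move=> a0 cG G0; pose F (v : R) : R := (v - u) / a.
have dF (v : R) : is_derive v 1 F a^-1 by exact: is_derive_affine.
have F'E : F^`()%classic = cst a^-1.
  by apply/funext => v; rewrite derive1E; have [_ ->] := dF v.
have mG : measurable_fun setT (G \o F).
  apply: measurableT_comp; first exact: continuous_measurable_fun.
  apply: continuous_measurable_fun => v.
  apply: differentiable_continuous; apply/derivable1_diffP.
  by have [] := dF v.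
have E : (\int[mu]_x (G x)%:E = a^-1%:E * \int[mu]_x (G (F x))%:E)%E.
  rewrite -ge0_integralZl//; last 3 first.
  - exact/measurable_EFinP.
  - by move=> x _; rewrite lee_fin G0.
  - by rewrite lee_fin invr_ge0 ltW.
  rewrite (@increasing_ge0_integration_by_substitutionT _ F)//.
  - by apply: eq_integral => x _; rewrite F'E /= -EFinM mulrC.
  - by move=> x y xy; rewrite ltr_pM2r ?invr_gt0// ltrD2r.
  - by rewrite F'E => v; exact: cvg_cst.
  - by rewrite F'E; exact: is_cvg_cst.
  - by rewrite F'E; exact: is_cvg_cst.
  - by apply/gt0_cvgMlNy; [rewrite invr_gt0|exact: cvg_addrr_Ny].
  - by apply/gt0_cvgMly; [rewrite invr_gt0|exact: cvg_addrr].
rewrite /Rintegral E; case: (\int[mu]_x _)%E => [r| |] /=.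
- by rewrite mulVKf ?gt_eqF.
- by rewrite gt0_muley ?lte_fin ?invr_gt0//= mulr0.
- by rewrite gt0_muleNy ?lte_fin ?invr_gt0//= mulr0.
Qed.

Lemma continuous_hermite_fun n : continuous (@hermite_fun R n).
Proof.
move=> x; apply: cvgM.
  by apply: cvgM; [exact: cvg_cst|exact: continuous_horner].
apply: (cvg_comp (fun y : R => - y ^+ 2 / 2) expR); last exact: continuous_expR.
apply: cvgM; last exact: cvg_cst.
apply: (@cvgN _ R^o); exact: sqr_continuous.
Qed.

(** The coefficients of v times the sum of the [c n] psi_n at xi = (v - u) / a;
    the predecessor at n = 0 is harmless since [ladder 0 = 0]. *)
Definition velocity_coef (u a : R) (c : nat -> R) (n : nat) : R :=
  u * c n + a * (ladder n * c n.-1 + ladder n.+1 * c n.+1).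

(** Symmetry of the tridiagonal matrix.  The right-hand side has one more mode,
    as [velocity_coef u a c] may be nonzero at [N]. *)
Lemma velocity_coef_adjoint (u a : R) (c h : nat -> R) N :
    (forall n, (N <= n)%N -> c n = 0) ->
  \sum_(n < N) c n * velocity_coef u a h n =
  \sum_(n < N.+1) velocity_coef u a c n * h n.
Proof.
move=> c0.
have down : \sum_(n < N) c n * (ladder n * h n.-1) =
    \sum_(n < N.+1) ladder n.+1 * c n.+1 * h n.
  (* Two vanishing terms are added, so that removing the first term, where
     [ladder 0 = 0], leaves the range of the right-hand side. *)
  transitivity (\sum_(n < N.+2) c n * (ladder n * h n.-1)).
    by rewrite !big_ord_recr /= !c0// ?leqnSn// !mul0r !addr0.
  rewrite big_ord_recl ladder0 mul0r mulr0 add0r.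
  by apply: eq_bigr => i _; rewrite /=; ring.
have up : \sum_(n < N) c n * (ladder n.+1 * h n.+1) =
    \sum_(n < N.+1) ladder n * c n.-1 * h n.
  rewrite big_ord_recl ladder0 !mul0r add0r.
  by apply: eq_bigr => i _; rewrite /=; ring.
have same : \sum_(n < N) c n * h n = \sum_(n < N.+1) c n * h n.
  by rewrite big_ord_recr /= c0// mul0r addr0.
under eq_bigr do rewrite /velocity_coef mulrDr mulrCA (mulrCA _ a) mulrDr.
rewrite big_split/= -!mulr_sumr big_split/= down up same.
rewrite -big_split/= !mulr_sumr -big_split/=.
by apply: eq_bigr => n _; rewrite /velocity_coef; ring.
Qed.

Lemma hermite_sum_velocity (u a : R) (c : nat -> R) N x :
    (forall n, (N <= n)%N -> c n = 0) ->
  (u + a * x) * \sum_(n < N) c n * hermite_fun n x =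
  \sum_(n < N.+1) velocity_coef u a c n * hermite_fun n x.
Proof.
move=> c0; rewrite -(velocity_coef_adjoint _ _ (fun n => hermite_fun n x))//.
rewrite mulr_sumr; apply: eq_bigr => n _.
by rewrite /velocity_coef -hermite_three_term; ring.
Qed.

(** Parseval for v times the expansion. *)
Lemma integral_velocity (u a : R) (c : nat -> R) N : 0 < a ->
    (forall n, (N <= n)%N -> c n = 0) ->
  \int[mu]_v (v ^+ 2 * (\sum_(n < N) c n * hermite_fun n ((v - u) / a)) ^+ 2)
  = a * \sum_(n < N.+1) velocity_coef u a c n ^+ 2.
Proof.
move=> a0 c0; pose q := velocity_coef u a c.
pose G x := (\sum_(n < N.+1) q n * hermite_fun n x) ^+ 2.
rewrite -integral_hermite_sqr -[RHS]/(a * \int[mu]_x G x) -(@integral_affine G u)//.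
- apply: eq_Rintegral => v _; rewrite -exprMn.
  have {1}-> : v = u + a * ((v - u) / a) by field; rewrite gt_eqF.
  by rewrite hermite_sum_velocity.
- have cS : continuous (fun x => \sum_(n < N.+1) q n * hermite_fun n x).
    apply: continuous_big => [|n _ x]; first exact: add_continuous.
    apply: cvgM; first exact: cvg_cst.
    exact: continuous_hermite_fun.
  by move=> x; rewrite /G; apply: cvgM; exact: cS.
- by move=> x; exact: sqr_ge0.
Qed.

End Hermite.

(** * Centered differences as a polynomial in the shift *)

Section CenteredDifferenceSymbol.
Variable R : realFieldType.
Implicit Types (p q : {poly R}) (f g : nat -> R) (r i m n : nat).

(** The weights of the centered difference of order 2 r, with unit spacing and
    index shifted to k = i - r.  Written with a binomial coefficient, one formula
    covers both signs of k, the center (where the inverse of 0 is 0) and the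
    indices beyond 2 r. *)
Definition cd_coef r i : R :=
  (-1) ^+ (i + r).+1 * (r`!%:R ^+ 2 / (r.*2)`!%:R) * 'C(r.*2, i)%:R
  / (i%:R - r%:R).

Definition cd_gain r : R := r`!%:R ^+ 2 / (2 * r.*2.+1`!%:R).

(** With S for 'X, this is S^r times
    (S - S^-1) times the sum over j < r of [cd_gain j] (2 - S - S^-1)^j. *)
Fixpoint cd_poly r : {poly R} :=
  if r is r'.+1 then
    'X * cd_poly r' + ((-1) ^+ r' * cd_gain r') *:
      (('X^2 - 1) * (1 - 'X) ^+ r'.*2)
  else 0.

Lemma coef_1subX_exp n i : ((1 - 'X) ^+ n : {poly R})`_i = (-1) ^+ i * 'C(n, i)%:R.
Proof.
elim: n i => [|n IHn] i.
  by rewrite expr0 coef1 bin0n; case: i => [|i]; rewrite /= ?mulr1 ?mulr0.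
rewrite exprS mulrBl mul1r coefB coefXM !IHn; case: i => [|i] /=.
  by rewrite subr0 !bin0.
by rewrite binS natrD exprS; ring.
Qed.

Lemma mulS_bin n i :
  i.+1%:R * 'C(n, i.+1)%:R = (n%:R - i%:R) * 'C(n, i)%:R :> R.
Proof.
have [in_|ni] := leqP i n; first by rewrite -natrB// -!natrM mul_bin_left.
by rewrite !bin_small// ?mulr0// ltnW.
Qed.

(** The order is raised by one term of the factored form; on coefficients this
    is an identity between 'C(2 r, i), 'C(2 r, i + 1) and 'C(2 r, i + 2), which
    are rational multiples of each other. *)
Lemma coef_cd_poly r i : (cd_poly r)`_i = cd_coef r i.
Proof.
elim: r i => [|r IHr] i.
  rewrite coef0 /cd_coef bin0n; case: i => [|i] /=.
    by rewrite subrr invr0 mulr0.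
  by rewrite mulr0 mul0r.
have F0 : (r.*2)`!%:R != 0 :> R by rewrite pnatr_eq0 -lt0n fact_gt0.
have S0 n : n.+1%:R != 0 :> R by rewrite pnatr_eq0.
have fE : r.+1`!%:R ^+ 2 = r.+1%:R ^+ 2 * r`!%:R ^+ 2 :> R.
  by rewrite factS natrM exprMn.
have dE : (r.+1.*2)`!%:R = r.*2.+2%:R * (r.*2.+1%:R * (r.*2)`!%:R) :> R.
  by rewrite doubleS !factS !natrM.
have hE : r.*2.+1`!%:R = r.*2.+1%:R * (r.*2)`!%:R :> R by rewrite factS natrM.
rewrite [cd_poly r.+1]/= coefD coefXM coefZ mulrBl mul1r coefB.
rewrite coefXnM !coef_1subX_exp IHr /cd_coef /cd_gain fE dE hE.
have d2 : r.*2%:R = 2 * r%:R :> R by rewrite -mul2n natrM.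
have r1 : r%:R + 1 != 0 :> R by rewrite natr1.
have r2 : 2 * r%:R + 1 != 0 :> R by rewrite -d2 natr1.
have r12 : 2 * r%:R + 1 + 1 != 0 :> R by rewrite -d2 !natr1.
move: (r`!%:R ^+ 2) {fE dE hE} (r.*2)`!%:R F0 => G F F0.
case: i => [|[|i]] /=.
- by rewrite !bin0 -!natr1 d2 add0n !exprS; field; rewrite ?r1 ?r2 ?r12 ?F0.
- rewrite !bin1 bin0 add1n doubleS -!natr1 d2 !exprS expr0.
  have [->|r_gt0] := posnP r.
    by rewrite !(mulr0, mul0r, add0r, subr0, subrr, mulr0n, oppr0, invr0).
  have r0 : r%:R != 0 :> R by rewrite pnatr_eq0 -lt0n.
  have r10 : 1 - (r%:R + 1) != 0 :> R.
    by rewrite opprD addrCA subrr addr0 oppr_eq0.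
  by field; rewrite r10 r0 r2 r12 F0.
have i1 : i%:R + 1 != 0 :> R by rewrite natr1.
have i2 : i%:R + 1 + 1 != 0 :> R by rewrite !natr1.
have yE : 'C(r.*2, i.+1)%:R =
    (2 * r%:R - i%:R) / (i%:R + 1) * 'C(r.*2, i)%:R :> R.
  apply: (mulfI (S0 i)); rewrite mulS_bin d2 -natr1.
  by field.
have zE : 'C(r.*2, i.+2)%:R =
    (2 * r%:R - i%:R - 1) / (i%:R + 1 + 1) * 'C(r.*2, i.+1)%:R :> R.
  apply: (mulfI (S0 i.+1)); rewrite mulS_bin d2 -!natr1.
  by field.
rewrite subn2 /= doubleS !binS !natrD zE yE !addSn !addnS !exprS exprD.
(* At the center both weights are 0 by convention, and the correction vanishes
   by symmetry of the binomial coefficients. *)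
have [ir|ir] := eqVneq i.+1 r.
  have rE : r%:R = i%:R + 1 :> R by rewrite -ir natr1.
  rewrite -!natr1 d2 rE !subrr !invr0 !mulr0 add0r; move: r2; rewrite rE => r2.
  by field; rewrite F0 r2 i1 i2.
have k0 : i%:R + 1 - r%:R != 0 :> R by rewrite natr1 subr_eq0 eqr_nat.
have k1 : i%:R + 1 + 1 - (r%:R + 1) != 0 :> R.
  by rewrite !natr1 subr_eq0 eqr_nat.
by rewrite -!natr1 d2; field; rewrite k1 i1 i2 F0 r2 r12.
Qed.

Lemma size_cd_poly r : (size (cd_poly r) <= r.*2.+1)%N.
Proof.
apply/leq_sizeP => i ri; rewrite coef_cd_poly /cd_coef bin_small//.
by rewrite mulr0 mul0r.
Qed.

(** The polynomial [p] evaluated at the shift f |-> f (_ + 1). *)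
Definition shift_poly p f m : R := \sum_(i < size p) p`_i * f (m + i)%N.

Lemma shift_poly_widen n p f m :
  (size p <= n)%N -> shift_poly p f m = \sum_(i < n) p`_i * f (m + i)%N.
Proof.
move=> pn; rewrite /shift_poly (big_ord_widen n (fun i => p`_i * f (m + i)%N) pn).
rewrite big_mkcond /=; apply: eq_bigr => i _; case: ltnP => // /(nth_default 0) ->.
by rewrite mul0r.
Qed.

Lemma shift_polyD p q f m :
  shift_poly (p + q) f m = shift_poly p f m + shift_poly q f m.
Proof.
pose n := maxn (size p) (size q).
rewrite (@shift_poly_widen n (p + q)) ?size_polyD// (@shift_poly_widen n p) ?leq_maxl//.
rewrite (@shift_poly_widen n q) ?leq_maxr// -big_split/=.
by apply: eq_bigr => i _; rewrite coefD mulrDl.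
Qed.

Lemma shift_polyZ (a : R) p f m : shift_poly (a *: p) f m = a * shift_poly p f m.
Proof.
rewrite (@shift_poly_widen (size p)) ?size_scale_leq// /shift_poly mulr_sumr.
by apply: eq_bigr => i _; rewrite coefZ mulrA.
Qed.

Lemma shift_polyB p q f m :
  shift_poly (p - q) f m = shift_poly p f m - shift_poly q f m.
Proof. by rewrite shift_polyD -[- q]scaleN1r shift_polyZ mulN1r. Qed.

Lemma shift_polyXM p f m : shift_poly ('X * p) f m = shift_poly p f m.+1.
Proof.
rewrite (@shift_poly_widen (size p).+1); last first.
  by rewrite (leq_trans (size_polyMleq _ _))// size_polyX.
rewrite big_ord_recl coefXM mul0r add0r; apply: eq_bigr => i _.
by rewrite coefXM /= addSnnS.
Qed.

Definition fdiff f m : R := f m - f m.+1.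

Lemma shift_poly_1subX_expM n p f m :
  shift_poly ((1 - 'X) ^+ n * p) f m = iter n fdiff (shift_poly p f) m.
Proof.
elim: n m => [|n IHn] m; first by rewrite mul1r.
by rewrite exprS -mulrA mulrBl mul1r shift_polyB shift_polyXM !IHn.
Qed.

Definition skip2 f m : R := f m.+2 - f m.

(** The factored form of the centered difference; the shift of the j-th term
    comes from S^r (2 - S - S^-1)^j = (-1)^j S^(r-j) (1 - S)^(2 j). *)
Lemma shift_poly_cd r f m : shift_poly (cd_poly r) f m =
  \sum_(j < r) (-1) ^+ j * cd_gain j * iter j.*2 fdiff (skip2 f) (m + (r.-1 - j))%N.
Proof.
have shift2 : shift_poly ('X^2 - 1) f = skip2 f.
  apply/funext => k; rewrite shift_polyB -['X^2]mulr1 exprS expr1.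
  rewrite -mulrA !shift_polyXM; have one l : shift_poly 1 f l = f l.
    by rewrite /shift_poly size_poly1 big_ord1 coef1 mul1r addn0.
  by rewrite !one.
elim: r m => [|r IHr] m; first by rewrite big_ord0 /shift_poly size_poly0 big_ord0.
rewrite [cd_poly _]/= shift_polyD shift_polyZ shift_polyXM IHr.
rewrite big_ord_recr /= subnn addn0.
rewrite [('X^2 - 1) * _]mulrC shift_poly_1subX_expM shift2.
congr (_ + _); apply: eq_bigr => j _.
have r0 : (0 < r)%N by exact: leq_ltn_trans (ltn_ord j).
by rewrite addSnnS -subSn ?prednK// -ltnS prednK.
Qed.

Definition periodic N f := forall m, f (m + N)%N = f m.

Lemma sum_periodic N f k : periodic N f ->
  \sum_(i < N) f (i + k)%N = \sum_(i < N) f i.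
Proof.
move=> fN; elim: k => [|k <-]; first by apply: eq_bigr => i _; rewrite addn0.
case: N fN => [|N] fN; first by rewrite !big_ord0.
rewrite big_ord_recr [RHS]big_ord_recl /= addrC; congr (_ + _).
  by rewrite addnS -addSn addnC fN add0n.
by apply: eq_bigr => i _; rewrite /bump /= add1n addnS addSn.
Qed.

Lemma periodic_iter N f j : periodic N f -> periodic N (iter j fdiff f).
Proof.
by move=> fN; elim: j => //= j IHj m; rewrite /fdiff IHj -addSn IHj.
Qed.

(** Summation by parts: the adjoint of 1 - S is - S^-1 (1 - S). *)
Lemma sum_iter_fdiff N f g j : periodic N f -> periodic N g ->
  \sum_(i < N) f (i + j)%N * iter j fdiff g i =
  (-1) ^+ j * \sum_(i < N) iter j fdiff f i * g i.
Proof.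
elim: j f => [|j IHj] f fN gN.
  by rewrite mul1r; apply: eq_bigr => i _; rewrite addn0.
have -> : \sum_(i < N) iter j.+1 fdiff f i * g i =
    \sum_(i < N) iter j fdiff (fdiff f) i * g i.
  by apply: eq_bigr => i _; rewrite iterSr.
rewrite exprS -mulrA -IHj//; last first.
  by move=> m; rewrite /fdiff fN -addSn fN.
set h := iter j fdiff g; rewrite mulN1r -sumrN.
have hN : periodic N h by exact: periodic_iter.
transitivity (\sum_(i < N) f (i + j.+1)%N * h i -
    \sum_(i < N) f (i + 1 + j)%N * h (i + 1)%N).
  rewrite -sumrB; apply: eq_bigr => i _.
  by rewrite iterS -/h {1}/fdiff mulrBr addn1 addSnnS.
rewrite (@sum_periodic N (fun i => f (i + j)%N * h i)); last first.
  by move=> m; rewrite hN addnAC fN.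
by rewrite -sumrB; apply: eq_bigr => i _; rewrite /fdiff addnS -mulrBl -mulNr opprB.
Qed.

Lemma periodic_modn N f m : periodic N f -> f (m %% N)%N = f m.
Proof.
move=> fN; rewrite [in RHS](divn_eq m N) addnC.
by elim: (m %/ N)%N => [|k IHk]; rewrite ?addn0// mulSnr addnA fN.
Qed.

(** Pairing the difference of [f] with a shift of [skip2 f] gives a combination
    with positive coefficients of the squared norms of the iterated differences
    of [skip2 f], hence [skip2 f] vanishes. *)
Lemma cd_poly_kernel N r f : (0 < N)%N -> (0 < r)%N -> periodic N f ->
  (forall m, shift_poly (cd_poly r) f m = 0) -> forall m, f m.+2 = f m.
Proof.
move=> N0 r0 fN f0; pose g := skip2 f.
have gN : periodic N g by move=> m; rewrite /g /skip2 fN -!addSn fN.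
have ipE (j : 'I_r) :
    \sum_(i < N) g (i + r.-1)%N * iter j.*2 fdiff g (i + (r.-1 - j))%N =
    (-1) ^+ j * \sum_(i < N) iter j fdiff g i ^+ 2.
  have jr : (j <= r.-1)%N by rewrite -ltnS prednK.
  pose h i := g (i + j)%N * iter j.*2 fdiff g i.
  have hN : periodic N h.
    by move=> i; rewrite /h addnAC gN (periodic_iter _ gN).
  transitivity (\sum_(i < N) h (i + (r.-1 - j))%N).
    by apply: eq_bigr => i _; rewrite /h -addnA subnK.
  rewrite sum_periodic// /h -addnn; under eq_bigr do rewrite iterD.
  by rewrite sum_iter_fdiff//; exact: periodic_iter.
have sum0 : \sum_(j < r) cd_gain j * \sum_(i < N) iter j fdiff g i ^+ 2 = 0.
  transitivity (\sum_(i < N) g (i + r.-1)%N * shift_poly (cd_poly r) f i); last first.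
    by rewrite big1// => i _; rewrite f0 mulr0.
  under [RHS]eq_bigr do rewrite shift_poly_cd mulr_sumr.
  rewrite exchange_big /=; apply: eq_bigr => j _.
  transitivity ((-1) ^+ j * cd_gain j *
      ((-1) ^+ j * \sum_(i < N) iter j fdiff g i ^+ 2)).
    rewrite mulrACA -expr2 sqrr_sign mul1r//.
  rewrite -ipE mulr_sumr; apply: eq_bigr => i _; rewrite -/g; ring.
have gain_gt0 j : 0 < cd_gain j.
  by rewrite divr_gt0 ?mulr_gt0 ?exprn_gt0// ltr0n fact_gt0.
have sqr0 : \sum_(i < N) g i ^+ 2 = 0.
  apply/eqP; move/eqP: sum0; rewrite psumr_eq0; last first.
    move=> j _; rewrite mulr_ge0 ?(ltW (gain_gt0 _))//.
    by apply: sumr_ge0 => i _; exact: sqr_ge0.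
  move=> /allP /(_ (Ordinal r0) (mem_index_enum _)).
  by rewrite mulf_eq0 gt_eqF.
move=> m; apply/eqP; rewrite -subr_eq0 -/(skip2 f m) -/(g m).
rewrite -(periodic_modn m gN) -sqrf_eq0.
move/eqP: sqr0; rewrite psumr_eq0; last by move=> i _; exact: sqr_ge0.
by move=> /allP /(_ (Ordinal (ltn_pmod m N0)) (mem_index_enum _)).
Qed.

End CenteredDifferenceSymbol.

(** * The periodic finite difference matrix *)

Section FiniteDifferenceMatrix.
Variables (R : realType) (P : sw_params R).

Local Notation N := (Nx P).
Local Notation r := ((fd_order P)./2).
Local Notation D := (fd_mx P).

Lemma fd_orderE : fd_order P = r.*2.
Proof. by rewrite -[LHS]odd_double_half (negbTE (order_even P)). Qed.

Lemma half_order_gt0 : (0 < r)%N.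
Proof. by have := Defs.order_gt0 P; rewrite {1}fd_orderE double_gt0. Qed.

Lemma order2_lt_Nx : (r.*2 < N)%N.
Proof. by rewrite -fd_orderE order_lt_Nx. Qed.

Lemma Nx_gt0 : (0 < N)%N.
Proof. exact: leq_ltn_trans order2_lt_Nx. Qed.

Lemma dx_gt0 : 0 < dx P.
Proof. by rewrite divr_gt0 ?len_gt0// ltr0n Nx_gt0. Qed.

Definition gridpt m : 'I_N := Ordinal (ltn_pmod m Nx_gt0).

Definition unroll (x : 'cV[R]_N) m : R := x (gridpt m) 0.

Lemma gridpt_addNx m : gridpt (m + N) = gridpt m.
Proof. by apply: val_inj; rewrite /= modnDr. Qed.

Lemma gridpt_ord (j : 'I_N) : gridpt j = j.
Proof. by apply: val_inj; rewrite /= modn_small. Qed.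

Lemma periodic_unroll x : periodic N (unroll x).
Proof. by move=> m; rewrite /unroll gridpt_addNx. Qed.

Lemma fd_coef_cd i : (i < N)%N ->
  fd_coef P ((i + (N - r)) %% N) = (dx P)^-1 * cd_coef R r i.
Proof.
have rN := order2_lt_Nx; have r0 := half_order_gt0 => iN.
have dx0 : dx P != 0 by rewrite gt_eqF ?dx_gt0.
have f0 n : n`!%:R != 0 :> R by rewrite pnatr_eq0 -lt0n fact_gt0.
have binE k l : (k + l)%N = r.*2 -> (r.*2)`!%:R^-1 * 'C(r.*2, k)%:R =
    (k`!%:R * l`!%:R)^-1 :> R.
  move=> kl; have kr : (k <= r.*2)%N by rewrite -kl leq_addr.
  have /(congr1 (fun n => n%:R : R)) := bin_fact kr.
  rewrite -{2}kl addKn !natrM => <-.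
  by field; rewrite !f0 /= pnatr_eq0 -lt0n bin_gt0.
have cdE k l : (k + l)%N = r.*2 -> cd_coef R r k =
    (-1) ^+ (k + r).+1 * r`!%:R ^+ 2 / (k`!%:R * l`!%:R) / (k%:R - r%:R).
  by move=> kl; rewrite /cd_coef -binE//; ring.
have [ir|ri|ir] := ltngtP i r.
- rewrite modn_small; last lia.
  rewrite /fd_coef /fd_weight ifF; last by apply/negbTE; lia.
  have -> : (N - (i + (N - r)) = r - i)%N by lia.
  rewrite ifT; last lia.
  rewrite (@cdE i (r + (r - i))%N)//; last lia.
  have -> : (r - (r - i) = i)%N by lia.
  rewrite natrB; last exact: ltnW.
  have -> : (-1) ^+ (i + r).+1 = (-1) ^+ (r - i).+1 :> R.
    by rewrite -signr_odd -[RHS]signr_odd /= oddD oddB// 1?addbC// ltnW.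
  have d0 : r%:R - i%:R != 0 :> R by rewrite subr_eq0 eqr_nat gtn_eqF.
  have d1 : i%:R - r%:R != 0 :> R by rewrite -opprB oppr_eq0.
  by field; rewrite ?dx0 ?d0 ?d1 ?f0.
- have -> : (i + (N - r) = (i - r) + N)%N by lia.
  rewrite modnDr modn_small; last lia.
  have [ir2|ir2] := leqP i r.*2.
    rewrite /fd_coef /fd_weight ifT; last lia.
    rewrite (@cdE i (r - (i - r))%N)//; last lia.
    have -> : (r + (i - r) = i)%N by lia.
    rewrite natrB; last exact: ltnW.
    have -> : (-1) ^+ (i + r).+1 = (-1) ^+ (i - r).+1 :> R.
      by rewrite -signr_odd -[RHS]signr_odd /= oddD oddB// ltnW.
    have d1 : i%:R - r%:R != 0 :> R by rewrite subr_eq0 eqr_nat gtn_eqF.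
    by field; rewrite ?dx0 ?d1 ?f0.
  rewrite /cd_coef bin_small// mulr0 mul0r mulr0 /fd_coef.
  rewrite ifF; last by apply/negbTE; lia.
  by rewrite ifF//; apply/negbTE; lia.
- have -> : (i + (N - r) = N)%N by lia.
  rewrite modnn /cd_coef ir subrr invr0 !mulr0 /fd_coef /= subn0.
  by rewrite ifF//; apply/negbTE; lia.
Qed.

(** Shifting the row index by half the order makes all exponents of the shift
    nonnegative. *)
Lemma fd_mx_shift_poly (x : 'cV[R]_N) m : (D *m x) (gridpt (m + r)) 0 =
  (dx P)^-1 * shift_poly (cd_poly R r) (unroll x) m.
Proof.
have rN := order2_lt_Nx.
pose g l := D (gridpt (m + r)) (gridpt l) * unroll x l.
have gN : periodic N g by move=> l; rewrite /g periodic_unroll gridpt_addNx.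
transitivity (\sum_(i < N) g (i + m)%N).
  rewrite sum_periodic// mxE; apply: eq_bigr => k _.
  by rewrite /g /unroll gridpt_ord.
rewrite (@shift_poly_widen _ N); last exact: leq_trans (size_cd_poly _ _) rN.
rewrite mulr_sumr; apply: eq_bigr => i _; rewrite /g [(i + m)%N]addnC mulrA.
congr (_ * _); rewrite coef_cd_poly -fd_coef_cd// mxE /=; congr (fd_coef _ _).
apply/eqP; rewrite -(eqn_modDr (m + r)).
have -> : (i + (N - r) + (m + r) = m + i + N)%N by lia.
rewrite modnDr -(modnDmr _ (m + r)) -addnA subnK; last first.
  by rewrite ltnW// ltn_pmod// Nx_gt0.
by rewrite modnDr modn_mod.
Qed.

Lemma fd_mx_tr : D^T = - D.
Proof.
have rN := order2_lt_Nx; have N0 := Nx_gt0.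
apply/matrixP => j k; rewrite !mxE.
have jN := ltn_ord j; have kN := ltn_ord k.
wlog jk : j k jN kN / (j <= k)%N => [hwlog|].
  have [jk|kj] := leqP j k; first exact: hwlog.
  by rewrite -[LHS]opprK -hwlog// ltnW.
have -> : (k + (N - j) = (k - j) + N)%N by lia.
rewrite modnDr [X in - fd_coef _ X]modn_small; last lia.
have [->|jk0] := eqVneq (k : nat) j.
  rewrite subnn subnKC ?(ltnW jN)// modnn /fd_coef /= subn0.
  by rewrite ifF ?oppr0//; apply/negbTE; lia.
rewrite modn_small; last lia.
have -> : (j + (N - k) = N - (k - j))%N by lia.
rewrite /fd_coef; have [d1|d1] := boolP (1 <= k - j <= r)%N.
  rewrite ifF; last by apply/negbTE; lia.
  by rewrite subKn ?d1//; lia.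
have [d2|d2] := boolP (1 <= N - (k - j) <= r)%N.
  by rewrite opprK.
by rewrite subKn ?(negbTE d1) ?oppr0//; lia.
Qed.

(** A sequence of period 2 is a combination of 1 and (-1)^j; the second one is
    not periodic on an odd grid. *)
Lemma fd_mx_kernel (y : 'cV[R]_N) : D *m y = 0 ->
  exists2 ab : R * R, forall j : 'I_N, y j 0 = ab.1 + ab.2 * (-1) ^+ j
    & odd N -> ab.2 = 0.
Proof.
move=> Dy; have yS m : unroll y m.+2 = unroll y m.
  apply: (@cd_poly_kernel R N r) => //; first exact: Nx_gt0.
  - exact: half_order_gt0.
  - exact: periodic_unroll.
  move=> {}m; have := fd_mx_shift_poly y m; rewrite Dy mxE => /esym/eqP.
  by rewrite mulf_eq0 invr_eq0 gt_eqF ?dx_gt0//= => /eqP.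
have [a [b yE]] : exists a b, forall m, unroll y m = a + b * (-1) ^+ m.
  exists ((unroll y 0 + unroll y 1) / 2), ((unroll y 0 - unroll y 1) / 2) => m.
  pose f k := (unroll y 0 + unroll y 1) / 2 +
    (unroll y 0 - unroll y 1) / 2 * (-1) ^+ k.
  rewrite -[RHS]/(f m).
  suff [] : unroll y m = f m /\ unroll y m.+1 = f m.+1 by [].
  elim: m => [|m [IHm IHm1]].
    by rewrite /f expr0 expr1; split; field.
  by split=> //; rewrite yS IHm /f !exprS !mulN1r opprK.
exists (a, b) => [j|Nodd] /=; first by rewrite -yE /unroll gridpt_ord.
have := periodic_unroll y 0; rewrite add0n !yE -signr_odd Nodd expr1 expr0.
move/eqP; rewrite mulrN1 mulr1 (inj_eq (addrI _)) eq_sym -addr_eq0 -mulr2n.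
by rewrite mulrn_eq0 => /eqP.
Qed.

(** The residual y of the claim lies in the kernel of D, to which both e and the
    range of the pseudoinverse are orthogonal: so y is orthogonal to itself. *)
Lemma poisson_pinv (e rho : 'cV[R]_N) : D *m e = rho ->
    \sum_j e j 0 = 0 -> (~~ odd N -> \sum_(j < N) (-1) ^+ j * e j 0 = 0) ->
  e = mp_pinv D *m rho.
Proof.
move=> De e0 ea; have [AXA XAX AXs XAs] := mp_pinvP D.
pose y : 'cV[R]_N := e - mp_pinv D *m rho.
have Dy : D *m y = 0 by rewrite /y mulmxBr -De 2!mulmxA AXA subrr.
have [[a b] /= yE b0] := fd_mx_kernel Dy.
have ye : y^T *m e = 0.
  apply/matrixP => i j; rewrite !ord1 !mxE.
  under eq_bigr do rewrite mxE yE mulrDl -mulrA.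
  rewrite big_split /= -!mulr_sumr e0 mulr0 add0r.
  by case: (boolP (odd N)) => [/b0->|/ea->]; rewrite ?mul0r ?mulr0.
have yy : y^T *m y = 0.
  rewrite {2}/y mulmxBr ye -De mulmxA mulmxA -(mulmxA y^T) -XAs -trmx_mul.
  by rewrite -mulmxA Dy mulmx0 trmx0 mul0mx subrr.
have y0 : y = 0.
  apply/colP => i; rewrite [RHS]mxE; move/matrixP/(_ 0 0)/eqP: yy.
  rewrite [X in X == _]mxE [X in _ == X]mxE psumr_eq0 => [/allP|k _].
    move=> /(_ i (mem_index_enum _)).
    by rewrite implyTb [y^T _ _]mxE -expr2 sqrf_eq0 => /eqP.
  by rewrite [y^T _ _]mxE -expr2 sqr_ge0.
by apply/eqP; rewrite -subr_eq0 -/y y0.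
Qed.

End FiniteDifferenceMatrix.

(** * Telescoping over the modes *)

Local Notation dotmx := Defs.dotmx.

Section KineticRate.
Variable R : realType.
Implicit Types (u a : R) (c : nat -> R).

(** The coefficients of minus the derivative in xi of the expansion. *)
Definition force_coef c n : R := ladder R n * c n.-1 - ladder R n.+1 * c n.+1.

Definition force_flux u a c n : R :=
  - u ^+ 2 * (ladder R n * c n.-1 * c n)
  - 2 * u * a * ladder R n ^+ 2 * (c n.-1 ^+ 2 + c n ^+ 2)
  - a ^+ 2 * (ladder R n ^+ 2 * (ladder R n.-1 * c n.-2 * c n.-1
                + 3 * (ladder R n * c n.-1 * c n) + ladder R n.+1 * c n * c n.+1)
              - ladder R n.-1 * ladder R n * ladder R n.+1 * c n.-2 * c n.+1).

(** Since xi and the derivative in xi have commutator one, V^2 and the force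
    operator have a commutator proportional to V; on the diagonal of the pairing
    this is the term a C_n Q_n, up to differences. *)
Lemma force_telescope u a c n :
  velocity_coef u a (velocity_coef u a c) n * force_coef c n
    - a * (c n * velocity_coef u a c n)
  = force_flux u a c n.+1 - force_flux u a c n.
Proof.
(* With 1/2 as a variable h, the only relation in use is the increment
   of the squares of the ladder coefficients. *)
pose h : R := 2^-1.
have lS k : ladder R k.+1 ^+ 2 = ladder R k ^+ 2 + h.
  by rewrite !sqr_ladder -natr1 mulrDl mul1r.
have -> : a * (c n * velocity_coef u a c n) =
    (h + h) * (a * (c n * velocity_coef u a c n)) by rewrite /h; field.
move: h lS; rewrite /velocity_coef /force_coef /force_flux.
move: (ladder R) (ladder0 R) => l l0 h lS; case: n => [|[|n]] /=.
- by have l1 := lS 0%N; rewrite l0 in l1 *; ring: l1.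
- by have l1 := lS 0%N; have l2 := lS 1%N; rewrite l0 in l1 *; ring: l1 l2.
- by have l3 := lS n.+2; ring: l3.
Qed.

(** Only the flux at the truncation survives; in it, the terms that contain the
    coefficients of index K + 1 and K + 2 vanish. *)
Lemma sum_force u a c K : (forall n, (K < n)%N -> c n = 0) ->
  \sum_(n < K.+1) velocity_coef u a (velocity_coef u a c) n * force_coef c n =
  a * (\sum_(n < K.+1) c n * velocity_coef u a c n)
  - u * a * K.+1%:R * c K ^+ 2
  - a ^+ 2 * (K.+1%:R / 2) * ladder R K * (c K.-1 * c K).
Proof.
move=> c0.
have flux0 : force_flux u a c 0 = 0 by rewrite /force_flux ladder0; ring.
have fluxK : force_flux u a c K.+1 = - (u * a * K.+1%:R * c K ^+ 2)
    - a ^+ 2 * (K.+1%:R / 2) * ladder R K * (c K.-1 * c K).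
  by rewrite /force_flux /= (c0 K.+1)// (c0 K.+2)// !sqr_ladder; field.
have : \sum_(n < K.+1) (velocity_coef u a (velocity_coef u a c) n *
    force_coef c n - a * (c n * velocity_coef u a c n)) =
    force_flux u a c K.+1 - force_flux u a c 0.
  rewrite -(telescope_sumr _ (leq0n _)) big_mkord.
  by apply: eq_bigr => n _; exact: force_telescope.
rewrite sumrB fluxK flux0 -mulr_sumr => /(canRL (subrK _)) ->; ring.
Qed.

Section Vectors.
Variables (M : nat) (D : 'M[R]_M).
Hypothesis Dtr : D^T = - D.
Implicit Types (x y : 'cV[R]_M) (v : nat -> 'cV[R]_M).

Lemma dotmxE x y : dotmx x y = \sum_j x j 0 * y j 0.
Proof. by rewrite /dotmx mxE; apply: eq_bigr => j _; rewrite mxE. Qed.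

Lemma dotmxZr k x y : dotmx x (k *: y) = k * dotmx x y.
Proof. by rewrite /Defs.dotmx -scalemxAr mxE. Qed.

Lemma dotmx_sumr (T : Type) (r : seq T) x (y : T -> 'cV[R]_M) :
  dotmx x (\sum_(i <- r) y i) = \sum_(i <- r) dotmx x (y i).
Proof. by rewrite /Defs.dotmx mulmx_sumr summxE. Qed.

Lemma dotmx_antisym x y : dotmx x (D *m y) = - dotmx y (D *m x).
Proof.
rewrite /dotmx -[in LHS](trmxK (x^T *m _)) mxE !trmx_mul trmxK Dtr.
by rewrite mulmxN mulNmx mxE mulmxA.
Qed.

Lemma dotmx_alt x : dotmx x (D *m x) = 0.
Proof.
apply/eqP; have /eqP := dotmx_antisym x x.
by rewrite -addr_eq0 -mulr2n mulrn_eq0.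
Qed.

Definition velocity_vec u a v n : 'cV[R]_M :=
  \col_j velocity_coef u a (fun k => v k j 0) n.

Lemma dotmx_velocity_vec u a v n y :
  dotmx (velocity_vec u a v n) y = velocity_coef u a (fun k => dotmx (v k) y) n.
Proof.
rewrite /velocity_coef !dotmxE !mulr_sumr -big_split/= mulr_sumr -big_split/=.
by apply: eq_bigr => j _; rewrite mxE /velocity_coef; ring.
Qed.

(** As [D] is antisymmetric, (V q)_n paired with D q_n is a difference of the
    fluxes <q_(n-1), D q_n>; at the truncation q_(K+1) is a multiple of v_K. *)
Lemma sum_transport u a v K : (forall n, (K < n)%N -> v n = 0) ->
  let q := velocity_vec u a v in
  \sum_(n < K.+1) dotmx (velocity_vec u a q n) (D *m q n) =
  a ^+ 3 * (K.+1%:R / 2) * ladder R K * dotmx (v K) (D *m v K.-1).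
Proof.
move=> v0 q; pose F n := a * (ladder R n * dotmx (q n.-1) (D *m q n)).
transitivity (\sum_(n < K.+1) (- F n.+1 - - F n)).
  apply: eq_bigr => n _; rewrite dotmx_velocity_vec /velocity_coef dotmx_alt.
  by rewrite (dotmx_antisym (q n.+1)) /F /=; ring.
rewrite -(big_mkord predT (fun n => - F n.+1 - - F n)) telescope_sumr//.
have qK : q K.+1 = (a * ladder R K.+1) *: v K.
  by apply/colP => j; rewrite !mxE /velocity_coef /= (v0 K.+1)// (v0 K.+2)// !mxE; ring.
rewrite /F ladder0 mul0r mulr0 oppr0 /= qK -scalemxAr dotmxZr dotmx_velocity_vec.
rewrite /velocity_coef dotmx_alt (v0 K.+1)//.
have -> : dotmx 0 (D *m v K) = 0 :> R.
  by rewrite dotmxE big1// => j _; rewrite mxE mul0r.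
rewrite (dotmx_antisym (v K)).
have <- := sqr_ladder R K.+1; ring.
Qed.

End Vectors.

End KineticRate.

(** * Kinetic energy and charge of one species *)

Section SpeciesRate.
Variables (R : realType) (M : nat) (D : 'M[R]_M).
Hypothesis Dtr : D^T = - D.

(** The force operator is antisymmetric, hence it preserves the sum of the
    squares of the coefficients. *)
Lemma velocity_force_sum0 (c : nat -> R) K : (forall n, (K < n)%N -> c n = 0) ->
  \sum_(n < K.+1) c n * force_coef c n = 0.
Proof.
move=> c0; pose F n := - (ladder R n * c n.-1 * c n).
transitivity (\sum_(n < K.+1) (F n.+1 - F n)).
  by apply: eq_bigr => n _; rewrite /F /force_coef /=; ring.
rewrite -(big_mkord predT (fun n => F n.+1 - F n)) telescope_sumr// /F.
by rewrite (c0 K.+1)// ladder0; ring.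
Qed.

(** Symmetry of V moves it from the rate d onto q, where the transport part of d
    and its force part telescope. *)
Lemma kinetic_rate (u a k : R) (v d : nat -> 'cV[R]_M) (e : 'cV[R]_M) K :
    (forall n, (K < n)%N -> v n = 0) -> (forall n, (K < n)%N -> d n = 0) ->
    let q := velocity_vec u a v in
    (forall n j, (n <= K)%N -> d n j 0 = - (D *m q n) j 0
        + k * (e j 0 * force_coef (fun i => v i j 0) n)) ->
  \sum_j \sum_(n < K.+2) q n j 0 * velocity_coef u a (fun i => d i j 0) n =
  - (a ^+ 3 * (K.+1%:R / 2) * ladder R K * dotmx (v K) (D *m v K.-1))
  + k * (a * dotmx e (\sum_(n < K.+1) (v n \odot q n))
         - u * a * K.+1%:R * dotmx e (v K \odot v K)
         - a ^+ 2 * (K.+1%:R / 2) * ladder R K * dotmx e (v K.-1 \odot v K)).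
Proof.
move=> v0 d0 q dE; rewrite -(sum_transport Dtr u a v0) -/q.
have cj0 j n : (K < n)%N -> v n j 0 = 0 by move=> /v0->; rewrite mxE.
transitivity (\sum_j (- (\sum_(n < K.+1)
      velocity_coef u a (fun i => q i j 0) n * (D *m q n) j 0)
    + k * (e j 0 * \sum_(n < K.+1)
      velocity_coef u a (fun i => q i j 0) n * force_coef (fun i => v i j 0) n))).
  apply: eq_bigr => j _; under eq_bigr do rewrite mulrC.
  rewrite -(velocity_coef_adjoint u a (fun n => q n j 0)); last first.
    by move=> n Kn; rewrite d0// mxE.
  rewrite -sumrN !mulr_sumr -big_split/=; apply: eq_bigr => n _.
  by rewrite dE; [ring|rewrite -ltnS].
rewrite big_split/= sumrN exchange_big/=; congr (- _ + _).
  apply: eq_bigr => n _; rewrite dotmxE; apply: eq_bigr => j _.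
  by rewrite [velocity_vec _ _ _ _ _ _]mxE.
rewrite -mulr_sumr !dotmxE; congr (k * _).
rewrite !mulr_sumr -!sumrB; apply: eq_bigr => j _.
have -> : (fun i => q i j 0) = velocity_coef u a (fun i => v i j 0).
  by apply/funext => i; rewrite mxE.
rewrite sum_force; last exact: cj0.
rewrite summxE !mxE.
rewrite [X in a * (e j 0 * X)](_ : _ = \sum_(n < K.+1) v n j 0 *
    velocity_coef u a (fun i => v i j 0) n).
  ring.
by apply: eq_bigr => n _; rewrite !mxE.
Qed.

End SpeciesRate.

(** * Energy balance along a solution *)

Section DerivativeCombinators.
Variables (R : realType) (t : R).
Implicit Types (f g : R -> R) (df dg k : R).

Lemma is_derive_mull k f df : is_derive t (1 : R) f df ->
  is_derive t (1 : R) (fun x => k * f x) (k * df).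
Proof. by move=> dfP; exact: is_deriveZ. Qed.

Lemma is_derive_add f g df dg : is_derive t (1 : R) f df ->
  is_derive t (1 : R) g dg -> is_derive t (1 : R) (fun x => f x + g x) (df + dg).
Proof. by move=> dfP dgP; exact: is_deriveD. Qed.

Lemma is_derive_sqr f df : is_derive t (1 : R) f df ->
  is_derive t (1 : R) (fun x => f x ^+ 2) (2 * (f t * df)).
Proof.
move=> dfP; apply: is_derive_eq (is_deriveX 2 dfP) _.
by rewrite /GRing.scale/=; ring.
Qed.

Lemma is_derive_bigsum (T : Type) (r : seq T) (F : T -> R -> R) (dF : T -> R) :
    (forall i, is_derive t (1 : R) (F i) (dF i)) ->
  is_derive t (1 : R) (fun x => \sum_(i <- r) F i x) (\sum_(i <- r) dF i).
Proof.
move=> dFi; elim: r => [|i r IHr].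
  rewrite big_nil; under eq_fun do rewrite big_nil; exact: is_derive_cst.
by rewrite big_cons; under eq_fun do rewrite big_cons; exact: is_deriveD.
Qed.

End DerivativeCombinators.

Section EnergyRate.
Variables (R : realType) (P : sw_params R) (C : coefs P) (E : efield P).

Local Notation K := (Nv P).-1.
Local Notation D := (fd_mx P).
Local Notation q := (sp_charge P).
Local Notation u := (sp_shift P).
Local Notation m := (sp_mass P).
Local Notation a := (sp_width P).

Lemma NvE : Nv P = K.+1.
Proof. by rewrite prednK// Defs.Nv_gt0. Qed.

(** Cutting to zero from N_v on makes sums over modes finite by themselves; a
    solution is unconstrained beyond N_v. *)
Definition modes s t n : 'cV[R]_(Nx P) :=
  if (n < Nv P)%N then C s n%:Z t else 0.

Lemma modes_lt s t n : (n < Nv P)%N -> modes s t n = C s n%:Z t.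
Proof. by rewrite /modes => ->. Qed.

Lemma modes_gt s t n : (K < n)%N -> modes s t n = 0.
Proof. by move=> Kn; rewrite /modes ltnNge (leq_trans _ Kn)//= -NvE. Qed.

Definition velocity_modes s t := velocity_vec (u s) (a s) (modes s t).

Lemma energy_kinE t : energy_kin C t = 2^-1 * \sum_s m s *
  (dx P * \sum_j (a s * \sum_(n < K.+2) velocity_modes s t n j 0 ^+ 2)).
Proof.
rewrite /energy_kin; congr (_ * _); apply: eq_bigr => s _; congr (_ * _).
rewrite /trapezoid; congr (_ * _); apply: eq_bigr => j _.
transitivity (\int[lebesgue_measure]_v (v ^+ 2 * (\sum_(n < Nv P)
    modes s t n j 0 * hermite_fun n ((v - u s) / a s)) ^+ 2)).
  apply: eq_Rintegral => v _; congr (_ * _ ^+ 2); apply: eq_bigr => n _.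
  by rewrite modes_lt.
rewrite (@integral_velocity _ _ _ (fun n => modes s t n j 0) _ (width_gt0 s));
  last first.
  by move=> n nN; rewrite modes_gt ?mxE// -ltnS -NvE.
rewrite [in LHS]NvE; congr (_ * _); apply: eq_bigr => n _.
by rewrite [velocity_modes _ _ _ _ _]mxE.
Qed.

Variables (I : set R) (t : R).
Hypotheses (oI : open I) (It : I t) (sol : sw_solution I C E).

(** The factor [ladder R n] vanishes at n = 0, so that truncated predecessors
    agree with the zero convention for negative modes. *)
Lemma coefs_pred s n : (n <= Nv P)%N ->
  ladder R n *: C s (n%:Z - 1) t = ladder R n *: modes s t n.-1.
Proof.
case: n => [|n] nN; first by rewrite ladder0 !scale0r.
have -> : n.+1%:Z - 1 = n%:Z by rewrite intS addrC addKr.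
by rewrite modes_lt.
Qed.

Lemma coefs_succ s n : (n < Nv P)%N -> C s (n%:Z + 1) t = modes s t n.+1.
Proof.
move=> nN; have -> : n%:Z + 1 = n.+1%:Z by rewrite intS addrC.
have [nN'|nN'] := ltnP n.+1 (Nv P); first by rewrite modes_lt.
have -> : n.+1 = Nv P by apply/eqP; rewrite eqn_leq nN nN'.
by rewrite (sw_conv_hi sol)// modes_gt// NvE.
Qed.

Lemma QvecE s n : (n < Nv P)%N -> Qvec C s n t = velocity_modes s t n.
Proof.
move=> nN; have pE := coefs_pred s (ltnW nN).
rewrite /Qvec -!/(ladder R _) coefs_succ// -modes_lt// -scalerA pE.
by apply/colP => j; rewrite !mxE /velocity_coef; ring.
Qed.

Definition mode_rate s n : 'cV[R]_(Nx P) :=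
  if (n < Nv P)%N then sw_rhs C E s n t else 0.

Lemma mode_rateE s n j : (n <= K)%N -> mode_rate s n j 0 =
  - (D *m velocity_modes s t n) j 0 + q s / (m s * a s) *
    (E t j 0 * force_coef (fun i => modes s t i j 0) n).
Proof.
rewrite -ltnS -NvE => nN; have pE := coefs_pred s (ltnW nN).
rewrite /mode_rate nN /sw_rhs QvecE// coefs_succ// -!/(ladder R _) pE.
rewrite [LHS]mxE; congr (_ + _); first by rewrite [LHS]mxE.
by rewrite !mxE /force_coef.
Qed.

Lemma is_derive_modes s n j :
  is_derive t (1 : R) (fun t' => modes s t' n j 0) (mode_rate s n j 0).
Proof.
rewrite /modes /mode_rate; case: ifPn => nN; first exact: (sw_vlasov sol).
by under eq_fun do rewrite mxE; rewrite mxE; exact: is_derive_cst.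
Qed.

Lemma is_derive_velocity_modes s n j : is_derive t (1 : R)
  (fun t' => velocity_modes s t' n j 0)
  (velocity_coef (u s) (a s) (fun i => mode_rate s i j 0) n).
Proof.
under eq_fun do rewrite mxE; rewrite /velocity_coef.
have ? := is_derive_modes s n j; have ? := is_derive_modes s n.-1 j.
have ? := is_derive_modes s n.+1 j.
exact: is_derive_add.
Qed.

Lemma is_derive_energy_kin : is_derive t (1 : R) (energy_kin C)
  (dx P * \sum_s m s * a s * \sum_j \sum_(n < K.+2) velocity_modes s t n j 0 *
     velocity_coef (u s) (a s) (fun i => mode_rate s i j 0) n).
Proof.
have -> : energy_kin C = fun t' => dx P * \sum_s m s * a s *
    \sum_j \sum_(n < K.+2) (2^-1 * velocity_modes s t' n j 0 ^+ 2).
  apply/funext => t'; rewrite energy_kinE [dx P * _]mulr_sumr [LHS]mulr_sumr.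
  apply: eq_bigr => s _; rewrite !mulr_sumr; apply: eq_bigr => j _.
  by rewrite -mulr_sumr; ring.
apply: is_derive_mull; apply: is_derive_bigsum => s; apply: is_derive_mull.
apply: is_derive_bigsum => j; apply: is_derive_bigsum => n.
apply: is_derive_eq.
  exact: (is_derive_mull _ (is_derive_sqr (is_derive_velocity_modes s n j))).
by rewrite /=; field.
Qed.

Definition charge_density t' : 'cV[R]_(Nx P) :=
  \sum_s (q s * a s) *: \sum_(n < Nv P) (C s n%:Z t' \odot C s n%:Z t').

Lemma efieldE t' : I t' -> E t' = mp_pinv D *m charge_density t'.
Proof.
move=> It'; apply: poisson_pinv; first exact: (sw_poisson sol).
  have /eqP := sw_mean0 sol It'; rewrite /trapezoid mulf_eq0 gt_eqF ?dx_gt0//=.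
  by move/eqP.
exact: (sw_gauge sol).
Qed.

Definition charge_rate : 'cV[R]_(Nx P) := (-2) *:
  \sum_s (q s * a s) *: \sum_(n < Nv P) (C s n%:Z t \odot (D *m Qvec C s n t)).

(** The force does not change the sum of the squares of the coefficients at a
    grid point, so that only transport remains. *)
Lemma is_derive_charge_density k :
  is_derive t (1 : R) (fun t' => charge_density t' k 0) (charge_rate k 0).
Proof.
have -> : (fun t' => charge_density t' k 0) = fun t' =>
    \sum_s (q s * a s) * \sum_(n < Nv P) C s n%:Z t' k 0 ^+ 2.
  apply/funext => t'; rewrite summxE; apply: eq_bigr => s _.
  by rewrite mxE summxE; congr (_ * _); apply: eq_bigr => n _; rewrite mxE expr2.
apply: is_derive_eq.
  apply: is_derive_bigsum => s; apply: is_derive_mull.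
  apply: is_derive_bigsum => n; apply: is_derive_sqr.
  exact: (sw_vlasov sol).
rewrite /charge_rate mxE summxE mulr_sumr; apply: eq_bigr => s _.
rewrite mxE mulrCA summxE; congr (_ * _).
pose c i := modes s t i k 0.
have c0 i : (K < i)%N -> c i = 0 by move=> Ki; rewrite /c modes_gt// mxE.
have := velocity_force_sum0 c0; rewrite -NvE => force0.
transitivity (\sum_(n < Nv P) (- 2 * (C s n%:Z t k 0 * (D *m Qvec C s n t) k 0)
   + 2 * (q s / (m s * a s) * E t k 0) * (c n * force_coef c n))).
  apply: eq_bigr => n _; have nN := ltn_ord n.
  have := mode_rateE s k (_ : (n <= K)%N); rewrite -ltnS -NvE => /(_ nN).
  rewrite /mode_rate nN => ->; rewrite QvecE// /c modes_lt//.
  by rewrite -/(force_coef _ _); ring.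
rewrite big_split/= -!mulr_sumr force0 mulr0 addr0; congr (_ * _).
by apply: eq_bigr => n _; rewrite [RHS]mxE.
Qed.

(** The formula for [E] holds near [t] only, because [I] is open. *)
Lemma is_derive_energy_pot : is_derive t (1 : R) (energy_pot E)
  (dx P * dotmx (E t) (mp_pinv D *m charge_rate)).
Proof.
have dE j : is_derive t (1 : R) (fun t' => E t' j 0)
    ((mp_pinv D *m charge_rate) j 0).
  apply: (@near_eq_is_derive _ _ _
    (fun t' => \sum_k mp_pinv D j k * charge_density t' k 0)).
    near=> t'; rewrite efieldE ?mxE//; near: t'; exact: open_nbhs_nbhs.
  rewrite mxE; apply: is_derive_bigsum => k; apply: is_derive_mull.
  exact: is_derive_charge_density.
rewrite /energy_pot /trapezoid; apply: is_derive_eq.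
  exact: (is_derive_mull _ (is_derive_mull _
    (is_derive_bigsum _ (fun j => is_derive_sqr (dE j))))).
by rewrite /= -mulr_sumr dotmxE; field.
Unshelve. all: end_near. Qed.

Lemma coefs_last s : C s ((Nv P)%:Z - 1) t = modes s t K.
Proof.
have -> : (Nv P)%:Z - 1 = K%:Z by rewrite [X in X%:Z]NvE intS addrC addKr.
by rewrite modes_lt// [X in (_ < X)%N]NvE.
Qed.

(** With a single mode the coefficient of index N_v - 2 is not the mode K - 1,
    but then the factor [ladder R K] is zero. *)
Lemma coefs_before_last s (f : 'cV[R]_(Nx P) -> R) :
  ladder R K * f (C s ((Nv P)%:Z - 2) t) = ladder R K * f (modes s t K.-1).
Proof.
have [->|K0] := posnP K; first by rewrite ladder0 !mul0r.
have -> : (Nv P)%:Z - 2 = K.-1%:Z.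
  by rewrite [X in X%:Z]NvE -{1}(prednK K0) !intS; ring.
by rewrite modes_lt// [X in (_ < X)%N]NvE ltnS leq_pred.
Qed.

Lemma drift_rateE : drift_rate C E t =
  dx P * (\sum_s m s * a s * \sum_j \sum_(n < K.+2) velocity_modes s t n j 0 *
     velocity_coef (u s) (a s) (fun i => mode_rate s i j 0) n)
  + dx P * dotmx (E t) (mp_pinv D *m charge_rate).
Proof.
have Dtr := fd_mx_tr P.
rewrite /drift_rate /=; congr (_ + _); last first.
  rewrite /charge_rate -scalemxAr.
  by rewrite dotmxZr; ring.
rewrite !dotmx_sumr.
have -> : Num.sqrt (((Nv P)%:R - 1) / 2) = ladder R K.
  by rewrite /ladder [X in X%:R - 1]NvE -natr1 addrK.
have tot s : m s * a s * (\sum_j \sum_(n < K.+2) velocity_modes s t n j 0 *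
      velocity_coef (u s) (a s) (fun i => mode_rate s i j 0) n) =
    - ((Nv P)%:R / 2) * (ladder R K * (a s ^+ 2 *
     (m s * a s ^+ 2 * dotmx (C s ((Nv P)%:Z - 1) t) (D *m C s ((Nv P)%:Z - 2) t) +
      q s * dotmx (E t) (C s ((Nv P)%:Z - 2) t \odot C s ((Nv P)%:Z - 1) t))))
    - (Nv P)%:R * dotmx (E t) ((q s * u s * a s) *:
       (C s ((Nv P)%:Z - 1) t \odot C s ((Nv P)%:Z - 1) t))
    + dotmx (E t) (\sum_(n < Nv P) (q s * a s) *: (C s n%:Z t \odot Qvec C s n t)).
  pose f x := a s ^+ 2 * (m s * a s ^+ 2 * dotmx (modes s t K) (D *m x) +
    q s * dotmx (E t) (x \odot modes s t K)).
  rewrite coefs_last -/(f _) coefs_before_last /f.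
  have rate0 n : (K < n)%N -> mode_rate s n = 0.
    by move=> Kn; rewrite /mode_rate ltnNge (leq_trans _ Kn)//= -NvE.
  rewrite (kinetic_rate Dtr (@modes_gt s t) rate0 (@mode_rateE s)) -NvE.
  have -> : \sum_(n < Nv P) (q s * a s) *: (C s n%:Z t \odot Qvec C s n t) =
      (q s * a s) *: \sum_(n < Nv P) (modes s t n \odot velocity_modes s t n).
    rewrite scaler_sumr; apply: eq_bigr => n _.
    by rewrite QvecE// modes_lt.
  rewrite !dotmxZr -/(velocity_modes s t).
  by field; rewrite !gt_eqF ?width_gt0 ?mass_gt0.
rewrite (eq_bigr _ (fun s _ => tot s)) 2!big_split/= sumrN -!mulr_sumr; ring.
Qed.

Lemma energy_drift : is_derive t (1 : R) (energy C E) (drift_rate C E t).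
Proof.
rewrite drift_rateE; exact: is_derive_add is_derive_energy_kin is_derive_energy_pot.
Qed.

End EnergyRate.

(** * A solution with varying energy *)

Section Example.
Variable R : realType.

Definition ex_params : sw_params R := @SwParams R bool
  (fun s => if s then 1 else -1) (fun=> 1) (fun=> 1) (fun=> 1) 4%:R 4 1 2
  (fun=> ltr01) (fun=> ltr01) (ltr0Sn R 3) isT isT isT isT.

Definition col4 (x0 x1 x2 x3 : R) : 'cV[R]_(Nx ex_params) :=
  \col_j nth 0 [:: x0; x1; x2; x3] j.

Lemma ex_dx : dx ex_params = 1.
Proof. by rewrite /dx /= divff. Qed.

Lemma sum4 (F : 'I_(Nx ex_params) -> R) : \sum_j F j =
  F (@Ordinal 4 0 isT) + F (@Ordinal 4 1 isT) + F (@Ordinal 4 2 isT)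
  + F (@Ordinal 4 3 isT).
Proof.
rewrite !big_ord_recl big_ord0 addr0 !addrA.
by do ![congr (_ + _)]; congr F; exact: val_inj.
Qed.

Lemma ord4_ind (Q : 'I_(Nx ex_params) -> Prop) :
  Q (@Ordinal 4 0 isT) -> Q (@Ordinal 4 1 isT) -> Q (@Ordinal 4 2 isT) ->
  Q (@Ordinal 4 3 isT) -> forall j, Q j.
Proof.
move=> Q0 Q1 Q2 Q3 [[|[|[|[|j]]]] jP] //=.
- by rewrite (bool_irrelevance jP isT).
- by rewrite (bool_irrelevance jP isT).
- by rewrite (bool_irrelevance jP isT).
- by rewrite (bool_irrelevance jP isT).
Qed.

Lemma ex_fd_mx x0 x1 x2 x3 : fd_mx ex_params *m col4 x0 x1 x2 x3 =
  col4 ((x1 - x3) / 2) ((x2 - x0) / 2) ((x3 - x1) / 2) ((x0 - x2) / 2).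
Proof.
have w1 : fd_weight ex_params 1 = 2^-1.
  rewrite /fd_weight ex_dx /= -[(1 - 1)`!]/1%N -[(1 + 1)`!]/2%N -[1`!]/1%N.
  by field.
apply/colP; apply: ord4_ind; rewrite mxE sum4 !mxE /fd_coef /= w1;
  by field.
Qed.

(** With one mode the force vanishes and each species is advected at speed 1:
    a stationary vector (the constant one, respectively the alternating one) plus
    a rotating mode.  Squares of the kernel parts and of the mode are common to
    both species, so that their charges cancel; the cross terms differ, and they
    are supported on the odd grid points. *)
Definition ex_coefs : coefs ex_params := fun s n t =>
  if n == 0 then
    if s then col4 (1 + cos t) (1 + sin t) (1 - cos t) (1 - sin t)
    else col4 (1 + cos t) (-1 + sin t) (1 - cos t) (-1 - sin t)
  else 0.

Definition ex_efield : efield ex_params := fun t =>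
  col4 (- 4 * sin t) 0 (4 * sin t) 0.

Lemma ex_solution : sw_solution setT ex_coefs ex_efield.
Proof.
split.
- by move=> s n t _ n0; rewrite /ex_coefs lt_eqF.
- by move=> s t _.
- move=> s [|//] t j _ _.
  have -> : sw_rhs ex_coefs ex_efield s 0 t = - (fd_mx ex_params *m ex_coefs s 0 t).
    rewrite /sw_rhs /Qvec.
    have -> : ex_coefs s (0%:Z - 1) t = 0 by [].
    have -> : ex_coefs s (0%:Z + 1) t = 0 by [].
    rewrite !scaler0 subrr !add0r /= scale1r.
    by apply/colP => k; rewrite !mxE mulr0 mulr0 addr0.
  rewrite /ex_coefs eqxx; case: s; rewrite ex_fd_mx; move: j; apply: ord4_ind;
    rewrite !mxE /=; under eq_fun do rewrite mxE /=;
    apply: is_derive_eq; rewrite /GRing.scale/=; by field.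
- move=> t _; rewrite /ex_efield ex_fd_mx big_bool /= !big_ord1 /ex_coefs /=.
  apply/colP; apply: ord4_ind; rewrite !mxE /=; by field.
- by move=> t _; rewrite /trapezoid sum4 !mxE /=; field.
- by move=> t _ _; rewrite sum4 !mxE /=; ring.
Qed.

Lemma ex_energy_kin t : energy_kin ex_coefs t = 9.
Proof.
have q2 s j : \sum_(n < 2) velocity_modes ex_coefs s t n j 0 ^+ 2 =
    3 / 2 * ex_coefs s 0 t j 0 ^+ 2.
  rewrite !big_ord_recl big_ord0 addr0 /velocity_modes /velocity_vec !mxE.
  rewrite /velocity_coef /modes /= mxE ladder0 !mulr0 !mul0r !addr0 add0r !mul1r.
  transitivity (ex_coefs s 0 t j 0 ^+ 2 + (ladder R 1 * ex_coefs s 0 t j 0) ^+ 2).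
    by rewrite addr0.
  by rewrite exprMn sqr_ladder; field.
rewrite energy_kinE ex_dx big_bool /= !sum4 !q2 /ex_coefs eqxx !mxE /= !mul1r.
have cs : sin t ^+ 2 = 1 - cos t ^+ 2 by rewrite -(cos2Dsin2 t); ring.
by field: cs.
Qed.

Lemma ex_energy_neq :
  energy ex_coefs ex_efield 0 != energy ex_coefs ex_efield (pi / 2).
Proof.
rewrite /energy !ex_energy_kin (inj_eq (addrI _)) /energy_pot /trapezoid ex_dx.
rewrite !sum4 !mxE /= sin0 sin_pihalf.
by apply/eqP; lra.
Qed.

End Example.

Theorem theorem9 (R : realType) :
  (forall (P : sw_params R) (I : set R) (C : coefs P) (E : efield P),
     open I -> is_interval I -> sw_solution I C E ->
     forall t : R, I t -> is_derive t 1 (energy C E) (drift_rate C E t))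
  /\
  (exists (P : sw_params R) (I : set R) (C : coefs P) (E : efield P),
     [/\ open I, is_interval I, sw_solution I C E
       & exists t t' : R, [/\ I t, I t' & energy C E t != energy C E t']]).
Proof.
split=> [P I C E oI _ sol t It|]; first exact: energy_drift oI It sol.
exists (ex_params R), setT, (@ex_coefs R), (@ex_efield R); split.
- exact: openT.
- by [].
- exact: ex_solution.
- by exists 0, (pi / 2); split=> //; exact: ex_energy_neq.
Qed.
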